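(* The relations $\to_{\mathrm{ss}}$ and $\to_{\mathrm{ms}}$ are confluent on clash-free terms: for $\to$ either of them, if $t$ is clash-free, $t\to^{*}s_1$ and $t\to^{*}s_2$, then there is $u$ with $s_1\to^{*}u$ and $s_2\to^{*}u$.
   Context: Exponential substitution calculus. Variables: multiplicative $m,n,o,\ldots$ and exponential $e,f,g,\ldots$ (disjoint kinds); $x,y,z$ range over both. Multiplicative values $v_{\mathsf m} ::= m \mid (t,s) \mid \lambda x.t$; exponential values $v_{\mathsf e} ::= e \mid\ !t$; values $v ::= v_{\mathsf m}\mid v_{\mathsf e}$. Terms: $t,s,u ::= v \mid \mathsf{cut}(v,x.t) \mid \mathsf{par}(m,x.y.t) \mid \mathsf{sub}(m,v,x.t) \mid \mathsf{der}(e,x.t)$; in $\lambda x.t$, cut, sub, der $x$ is bound in $t$, in par $x,y$ are bound; terms up to $\alpha$; $\mathrm{fv}$ = free variables. Left contexts $L ::= \langle\cdot\rangle \mid \mathsf{cut}(v,x.L)\mid\mathsf{par}(m,x.y.L)\mid\mathsf{sub}(m,v,x.L)\mid\mathsf{der}(e,x.L)$; every term is uniquely $L\langle v\rangle$. Value contexts $V ::= \langle\cdot\rangle \mid (C,s)\mid (t,C)\mid\lambda x.C\mid\ !C$; general contexts $C ::= V \mid \mathsf{cut}(V,x.t)\mid\mathsf{sub}(m,V,x.t)\mid L\langle C\rangle$; multiplicative value contexts $V_{\mathsf m} ::= \langle\cdot\rangle\mid (M,s)\mid(t,M)\mid\lambda x.M$; multiplicative contexts $M ::= V_{\mathsf m}\mid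 \mathsf{cut}(V_{\mathsf m},x.t)\mid \mathsf{sub}(m,V_{\mathsf m},x.t)\mid L\langle M\rangle$. Plugging $C\langle t\rangle$ replaces the hole (may capture), except that if $t=L\langle v\rangle$ then $\mathsf{cut}(\langle\cdot\rangle,x.s)\langle t\rangle := L\langle\mathsf{cut}(v,x.s)\rangle$ and $\mathsf{sub}(m,\langle\cdot\rangle,x.s)\langle t\rangle := L\langle\mathsf{sub}(m,v,x.s)\rangle$; $C\langle\!\langle t\rangle\!\rangle$ is capture-avoiding plugging. Meta-level substitution $\{v_{\mathsf e}/e\}t$ (capture-avoiding) commutes with all constructors, is the identity on variables other than $e$, $\{v_{\mathsf e}/e\}e := v_{\mathsf e}$, and $\{f/e\}\mathsf{der}(e,x.t) := \mathsf{der}(f,x.\{f/e\}t)$, $\{!L\langle v\rangle/e\}\mathsf{der}(e,x.t) := L\langle \mathsf{cut}(v,x.\{!L\langle v\rangle/e\}t)\rangle$. For multiplicative $m,n$, $\{n/m\}t$ is renaming. Root rules (context does not capture the cut variable): (ax$_{m1}$) $\mathsf{cut}(v_{\mathsf m},m.M\langle\!\langle m\rangle\!\rangle)\mapsto M\langle\!\langle v_{\mathsf m}\rangle\!\rangle$; (ax$_{m2}$) $\mathsf{cut}(n,m.t)\mapsto \{n/m\}t$; ($\otimes$) $\mathsf{cut}((s,u),m.M\langle\mathsf{par}(m,x.y.t)\rangle)\mapsto M\langle L\langle\mathsf{cut}(v,x.L'\langle\mathsf{cut}(v',y.t)\rangle)\rangle\rangle$ where $s=L\langle v\rangle$, $u=L'\langle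 v'\rangle$; ($\multimap$) $\mathsf{cut}(\lambda y.s,m.M\langle\mathsf{sub}(m,v,x.t)\rangle)\mapsto M\langle\mathsf{cut}(v,y.L\langle\mathsf{cut}(v',x.t)\rangle)\rangle$ where $s=L\langle v'\rangle$; (ax$_{e1}$) $\mathsf{cut}(v_{\mathsf e},e.C\langle\!\langle e\rangle\!\rangle)\mapsto\mathsf{cut}(v_{\mathsf e},e.C\langle\!\langle v_{\mathsf e}\rangle\!\rangle)$; (ax$_{e2}$) $\mathsf{cut}(f,e.C\langle\mathsf{der}(e,x.t)\rangle)\mapsto\mathsf{cut}(f,e.C\langle\mathsf{der}(f,x.t)\rangle)$; (!der) $\mathsf{cut}(!s,e.C\langle\mathsf{der}(e,x.t)\rangle)\mapsto\mathsf{cut}(!s,e.C\langle L\langle\mathsf{cut}(v,x.t)\rangle\rangle)$ where $s=L\langle v\rangle$; (w) $\mathsf{cut}(v_{\mathsf e},e.t)\mapsto t$ if $e\notin\mathrm{fv}(t)$; (ess) $\mathsf{cut}(v_{\mathsf e},e.t)\mapsto\{v_{\mathsf e}/e\}t$. Each induces $\to_a$ by closure under general contexts. $\to_{\mathsf m}$ = union of ax$_{m1}$, ax$_{m2}$, $\otimes$, $\multimap$; $\to_{\mathrm{ms}} = \to_{\mathsf m}\cup\to_{ax_{e1}}\cup\to_{ax_{e2}}\cup\to_{!der}\cup\to_w$; $\to_{\mathrm{ss}}=\to_{\mathsf m}\cup\to_{\mathrm{ess}}$. Clashes: terms of the form $\mathsf{cut}(v_{\mathsf m},e.t)$, $\mathsf{cut}(v_{\mathsf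 e},m.t)$, $\mathsf{cut}((t,s),m.M\langle\mathsf{sub}(m,v,y.u)\rangle)$, or $\mathsf{cut}(\lambda x.t,m.M\langle\mathsf{par}(m,y.z.u)\rangle)$. A term is clash-free if, coinductively, no subterm is a clash and every $\to_{\mathrm{ms}}$-reduct is clash-free.
   Formalization: Terms are additionally required to be proper: each bound multiplicative variable occurs exactly once and none is free under !. Without this the claim fails, e.g. cut((s,u),m.(m,m)) reduces to ((s,u),m) and (m,(s,u)). *)

(* Defs.v *)
From Stdlib Require Import Arith Relations.

(** Terms up to alpha-equivalence, in de Bruijn style.  The two kinds of
    variables are disjoint, so each kind has its own index space: the index of
    an occurrence counts the enclosing binders *of the same kind* only, and
    indices beyond all the enclosing binders denote the free variables. *)

Inductive kind := Mul | Exp.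

Inductive mvalue :=
| MVar (m : nat)
| Pair (t s : term)
| Lam (k : kind) (t : term)
with evalue :=
| EVar (e : nat)
| Bang (t : term)
with value :=
| VM (v : mvalue)
| VE (v : evalue)
with term :=
| Val (v : value)
| Cut (v : value) (k : kind) (t : term)
(* In [Par m k1 k2 t], standing for par(m,x.y.t), [y] is the innermost binder. *)
| Par (m : nat) (k1 k2 : kind) (t : term)
| Sub (m : nat) (v : value) (k : kind) (t : term)
| Der (e : nat) (k : kind) (t : term).

Definition kind_of (v : value) : kind :=
  match v with VM _ => Mul | VE _ => Exp end.

(** ** Renamings *)

Definition ren := kind -> nat -> nat.

Definition one (k k' : kind) : nat :=
  match k, k' with Mul, Mul | Exp, Exp => 1 | _, _ => 0 end.

Definition shift (n : kind -> nat) : ren := fun k i => n k + i.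

Definition wk (k : kind) : ren := shift (one k).

Definition rcomp (r2 r1 : ren) : ren := fun k i => r2 k (r1 k i).

Definition up (k : kind) (r : ren) : ren := fun k' i =>
  match one k k', i with
  | 0, _ => r k' i
  | S _, 0 => 0
  | S _, S j => S (r k' j)
  end.

Fixpoint ren_m (r : ren) (v : mvalue) : mvalue :=
  match v with
  | MVar m => MVar (r Mul m)
  | Pair t s => Pair (ren_t r t) (ren_t r s)
  | Lam k t => Lam k (ren_t (up k r) t)
  end
with ren_e (r : ren) (v : evalue) : evalue :=
  match v with
  | EVar e => EVar (r Exp e)
  | Bang t => Bang (ren_t r t)
  end
with ren_v (r : ren) (v : value) : value :=
  match v with
  | VM v => VM (ren_m r v)
  | VE v => VE (ren_e r v)
  end
with ren_t (r : ren) (t : term) : term :=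
  match t with
  | Val v => Val (ren_v r v)
  | Cut v k t => Cut (ren_v r v) k (ren_t (up k r) t)
  | Par m k1 k2 t => Par (r Mul m) k1 k2 (ren_t (up k2 (up k1 r)) t)
  | Sub m v k t => Sub (r Mul m) (ren_v r v) k (ren_t (up k r) t)
  | Der e k t => Der (r Exp e) k (ren_t (up k r) t)
  end.

(** The renaming {n/m} that also removes the binder of [m]. *)
Definition inst_mul (n : nat) : ren := fun k i =>
  match k, i with
  | Mul, 0 => n
  | Mul, S j => j
  | Exp, _ => i
  end.

(** ** Left contexts *)

Inductive lctx :=
| LHole
| LCut (v : value) (k : kind) (L : lctx)
| LPar (m : nat) (k1 k2 : kind) (L : lctx)
| LSub (m : nat) (v : value) (k : kind) (L : lctx)
| LDer (e : nat) (k : kind) (L : lctx).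

Fixpoint plug_l (L : lctx) (t : term) : term :=
  match L with
  | LHole => t
  | LCut v k L => Cut v k (plug_l L t)
  | LPar m k1 k2 L => Par m k1 k2 (plug_l L t)
  | LSub m v k L => Sub m v k (plug_l L t)
  | LDer e k L => Der e k (plug_l L t)
  end.

(** Number of binders of each kind above the hole. *)
Fixpoint nb_l (L : lctx) : kind -> nat := fun k' =>
  match L with
  | LHole => 0
  | LCut _ k L | LSub _ _ k L | LDer _ k L => one k k' + nb_l L k'
  | LPar _ k1 k2 L => one k1 k' + (one k2 k' + nb_l L k')
  end.

(** The unique decomposition of a term as [L<v>]. *)
Fixpoint split (t : term) : lctx * value :=
  match t with
  | Val v => (LHole, v)
  | Cut w k t => let (L, v) := split t in (LCut w k L, v)
  | Par m k1 k2 t => let (L, v) := split t in (LPar m k1 k2 L, v)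
  | Sub m w k t => let (L, v) := split t in (LSub m w k L, v)
  | Der e k t => let (L, v) := split t in (LDer e k L, v)
  end.

(** [L<cut(v,x.s)>] and [L<sub(m,v,x.s)>] for [t = L<v>]; here [m] and [s]
    live outside [L], which must not capture their variables. *)
Definition cut_at (t : term) (k : kind) (s : term) : term :=
  let (L, v) := split t in
  plug_l L (Cut v k (ren_t (up k (shift (nb_l L))) s)).

Definition sub_at (m : nat) (t : term) (k : kind) (s : term) : term :=
  let (L, v) := split t in
  plug_l L (Sub (shift (nb_l L) Mul m) v k (ren_t (up k (shift (nb_l L))) s)).

(** ** Value contexts and general contexts *)

Inductive vctx :=
| VHole
| VPairL (C : ctx) (s : term)
| VPairR (t : term) (C : ctx)
| VLam (k : kind) (C : ctx)
| VBang (C : ctx)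
with ctx :=
| CVal (V : vctx)
| CCut (V : vctx) (k : kind) (t : term)
| CSub (m : nat) (V : vctx) (k : kind) (t : term)
| CLeft (L : lctx) (C : ctx).

(** Plugging, possibly capturing.  When [V] is not the hole, [plug_v V t] is a
    value, and [cut_at] and [sub_at] just build a cut and a sub on it. *)
Fixpoint plug_v (V : vctx) (t : term) : term :=
  match V with
  | VHole => t
  | VPairL C s => Val (VM (Pair (plug C t) s))
  | VPairR s C => Val (VM (Pair s (plug C t)))
  | VLam k C => Val (VM (Lam k (plug C t)))
  | VBang C => Val (VE (Bang (plug C t)))
  end
with plug (C : ctx) (t : term) : term :=
  match C with
  | CVal V => plug_v V t
  | CCut V k s => cut_at (plug_v V t) k s
  | CSub m V k s => sub_at m (plug_v V t) k s
  | CLeft L C => plug_l L (plug C t)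
  end.

Fixpoint nb_v (V : vctx) : kind -> nat := fun k' =>
  match V with
  | VHole => 0
  | VPairL C _ | VPairR _ C | VBang C => nb C k'
  | VLam k C => one k k' + nb C k'
  end
with nb (C : ctx) : kind -> nat := fun k' =>
  match C with
  | CVal V | CCut V _ _ | CSub _ V _ _ => nb_v V k'
  | CLeft L C => nb_l L k' + nb C k'
  end.

(** Multiplicative contexts have the grammar of general contexts without the
    production [!C]. *)
Fixpoint mult_v (V : vctx) : Prop :=
  match V with
  | VHole => True
  | VPairL C _ | VPairR _ C | VLam _ C => mult C
  | VBang _ => False
  end
with mult (C : ctx) : Prop :=
  match C with
  | CVal V | CCut V _ _ | CSub _ V _ _ => mult_v V
  | CLeft _ C => mult C
  end.

(** ** Meta-level substitution of exponential values *)

Definition esub := nat -> evalue.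

Definition up_s (k : kind) (f : esub) : esub := fun i =>
  match k, i with
  | Mul, _ => ren_e (wk Mul) (f i)
  | Exp, 0 => EVar 0
  | Exp, S j => ren_e (wk Exp) (f j)
  end.

Fixpoint es_m (f : esub) (v : mvalue) : mvalue :=
  match v with
  | MVar m => MVar m
  | Pair t s => Pair (es_t f t) (es_t f s)
  | Lam k t => Lam k (es_t (up_s k f) t)
  end
with es_e (f : esub) (v : evalue) : evalue :=
  match v with
  | EVar e => f e
  | Bang t => Bang (es_t f t)
  end
with es_v (f : esub) (v : value) : value :=
  match v with
  | VM v => VM (es_m f v)
  | VE v => VE (es_e f v)
  end
with es_t (f : esub) (t : term) : term :=
  match t with
  | Val v => Val (es_v f v)
  | Cut v k t => Cut (es_v f v) k (es_t (up_s k f) t)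
  | Par m k1 k2 t => Par m k1 k2 (es_t (up_s k2 (up_s k1 f)) t)
  | Sub m v k t => Sub m (es_v f v) k (es_t (up_s k f) t)
  | Der e k t =>
      match f e with
      | EVar e' => Der e' k (es_t (up_s k f) t)
      | Bang s => cut_at s k (es_t (up_s k f) t)
      end
  end.

(** {v/e}, also removing the binder of [e]. *)
Definition inst_exp (v : evalue) : esub := fun i =>
  match i with 0 => v | S j => EVar j end.

(** ** Rewriting rules *)

Inductive rule := AxM1 | AxM2 | Tensor | Lolli | AxE1 | AxE2 | BangDer | Weak | Ess.

(** From outside a cut binding a variable of kind [k] to the hole of a context
    inside that cut. *)
Definition into (k : kind) (C : ctx) : ren := rcomp (shift (nb C)) (wk k).

(** The variable bound by a cut just outside [C] has index [nb C k] in the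
    hole.  The rules of the multiplicative group erase the cut, so their reduct
    is a term [r] without the cut variable: the plugged body has to be [r]
    weakened by that variable. *)
Inductive root : rule -> term -> term -> Prop :=
| root_axm1 v M r :
    mult M ->
    plug M (Val (VM (ren_m (into Mul M) v))) = ren_t (wk Mul) r ->
    root AxM1 (Cut (VM v) Mul (plug M (Val (VM (MVar (nb M Mul)))))) r
| root_axm2 n t :
    root AxM2 (Cut (VM (MVar n)) Mul t) (ren_t (inst_mul n) t)
| root_tensor s u M k1 k2 t r :
    mult M ->
    plug M (cut_at (ren_t (into Mul M) s) k1
             (cut_at (ren_t (rcomp (wk k1) (into Mul M)) u) k2 t))
      = ren_t (wk Mul) r ->
    root Tensor (Cut (VM (Pair s u)) Mul (plug M (Par (nb M Mul) k1 k2 t))) r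
| root_lolli k s M v k' t r :
    mult M ->
    plug M (Cut v k
             (cut_at (ren_t (up k (into Mul M)) s) k' (ren_t (up k' (wk k)) t)))
      = ren_t (wk Mul) r ->
    root Lolli (Cut (VM (Lam k s)) Mul (plug M (Sub (nb M Mul) v k' t))) r
| root_axe1 v C :
    root AxE1 (Cut (VE v) Exp (plug C (Val (VE (EVar (nb C Exp))))))
              (Cut (VE v) Exp (plug C (Val (VE (ren_e (into Exp C) v)))))
| root_axe2 f C k t :
    root AxE2 (Cut (VE (EVar f)) Exp (plug C (Der (nb C Exp) k t)))
              (Cut (VE (EVar f)) Exp (plug C (Der (into Exp C Exp f) k t)))
| root_bangder s C k t :
    root BangDer (Cut (VE (Bang s)) Exp (plug C (Der (nb C Exp) k t)))
                 (Cut (VE (Bang s)) Exp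
                   (plug C (cut_at (ren_t (into Exp C) s) k t)))
| root_weak v t :
    root Weak (Cut (VE v) Exp (ren_t (wk Exp) t)) t
| root_ess v t :
    root Ess (Cut (VE v) Exp t) (es_t (inst_exp v) t).

Inductive step (a : rule) : term -> term -> Prop :=
| step_ctx C t s : root a t s -> step a (plug C t) (plug C s).

Definition step_m : relation term :=
  union _ (step AxM1) (union _ (step AxM2) (union _ (step Tensor) (step Lolli))).

Definition step_ms : relation term :=
  union _ step_m
    (union _ (step AxE1) (union _ (step AxE2) (union _ (step BangDer) (step Weak)))).

Definition step_ss : relation term := union _ step_m (step Ess).

(** ** Clashes *)

Inductive clash : term -> Prop :=
| clash_kind v k t : kind_of v <> k -> clash (Cut v k t)
| clash_tensor t s M v k u :
    mult M -> clash (Cut (VM (Pair t s)) Mul (plug M (Sub (nb M Mul) v k u)))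
| clash_lolli k t M k1 k2 u :
    mult M -> clash (Cut (VM (Lam k t)) Mul (plug M (Par (nb M Mul) k1 k2 u))).

Fixpoint sub_m (c : term) (v : mvalue) : Prop :=
  match v with
  | MVar _ => False
  | Pair t s => subterm c t \/ subterm c s
  | Lam _ t => subterm c t
  end
with sub_e (c : term) (v : evalue) : Prop :=
  match v with
  | EVar _ => False
  | Bang t => subterm c t
  end
with sub_v (c : term) (v : value) : Prop :=
  match v with
  | VM v => sub_m c v
  | VE v => sub_e c v
  end
with subterm (c t : term) : Prop :=
  c = t \/
  match t with
  | Val v => sub_v c v
  | Cut v _ t | Sub _ v _ t => sub_v c v \/ subterm c t
  | Par _ _ _ t | Der _ _ t => subterm c t
  end.

CoInductive clash_free (t : term) : Prop := {
  no_clash : forall c, subterm c t -> ~ clash c;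
  reduct_clash_free : forall s, step_ms t s -> clash_free s
}.

(** ** Linearity of multiplicative variables *)

(** Number of free occurrences of a multiplicative variable. *)
Fixpoint occ_m (m : nat) (v : mvalue) : nat :=
  match v with
  | MVar n => if m =? n then 1 else 0
  | Pair t s => occ m t + occ m s
  | Lam k t => occ (wk k Mul m) t
  end
with occ_e (m : nat) (v : evalue) : nat :=
  match v with
  | EVar _ => 0
  | Bang t => occ m t
  end
with occ_v (m : nat) (v : value) : nat :=
  match v with
  | VM v => occ_m m v
  | VE v => occ_e m v
  end
with occ (m : nat) (t : term) : nat :=
  match t with
  | Val v => occ_v m v
  | Cut v k t => occ_v m v + occ (wk k Mul m) t
  | Par n k1 k2 t =>
      (if m =? n then 1 else 0) + occ (wk k2 Mul (wk k1 Mul m)) t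
  | Sub n v k t => (if m =? n then 1 else 0) + (occ_v m v + occ (wk k Mul m) t)
  | Der _ k t => occ (wk k Mul m) t
  end.

Definition binds_linearly (k : kind) (t : term) : Prop :=
  match k with Mul => occ 0 t = 1 | Exp => True end.

(** A multiplicative variable bound in a proper term occurs exactly once, and
    no multiplicative variable is free under a [!].  Confluence needs this: in
    the improper term cut((s,u), n.(cut(n, m.(m,m)), e)), [AxM1] on the outer
    cut gives (cut((s,u), m.(m,m)), e), [AxM2] on the inner one gives
    cut((s,u), n.((n,n), e)), and these have no common reduct. *)
Fixpoint proper_m (v : mvalue) : Prop :=
  match v with
  | MVar _ => True
  | Pair t s => proper t /\ proper s
  | Lam k t => binds_linearly k t /\ proper t
  end
with proper_e (v : evalue) : Prop :=
  match v with
  | EVar _ => True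
  | Bang t => (forall m, occ m t = 0) /\ proper t
  end
with proper_v (v : value) : Prop :=
  match v with
  | VM v => proper_m v
  | VE v => proper_e v
  end
with proper (t : term) : Prop :=
  match t with
  | Val v => proper_v v
  | Cut v k t => proper_v v /\ binds_linearly k t /\ proper t
  | Par _ k1 k2 t =>
      match k1 with Mul => occ (wk k2 Mul 0) t = 1 | Exp => True end /\
      binds_linearly k2 t /\ proper t
  | Sub _ v k t => proper_v v /\ binds_linearly k t /\ proper t
  | Der _ k t => binds_linearly k t /\ proper t
  end.

(** ** Confluence *)

Definition steps (R : relation term) : relation term := clos_refl_trans _ R.

Definition confluent_on (P : term -> Prop) (R : relation term) : Prop :=
  forall t s1 s2, P t -> steps R t s1 -> steps R t s2 ->
  exists u, steps R s1 u /\ steps R s2 u.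

(* Main.v *)
From Stdlib Require Import Arith Lia Relations FunctionalExtensionality.
Require Import Defs.

(** On clash-free proper terms, every rule that fires a cut is an instance of one
    equation: extend the meta-level substitution [{v/x}t] to multiplicative
    values, so that replacing [m] by a pair in [par(m,..)], or by an abstraction
    in [sub(m,..)], performs the corresponding interaction.  By linearity, the
    steps of the multiplicative group are then exactly
    [cut(v,m.t) -> {v/m}t], as (ess) is for exponential values.  When the
    substitution meets a clash, it rebuilds the clashing cut around it; this
    makes it total and compatible with composition, so the relation generated by
    [cut(v,x.t) -> {v/x}t] is confluent on all terms, by parallel reduction and
    complete developments.

    Every micro-step rule either is such a step or preserves [{v/e}t], so both
    [step_ss] and [step_ms] are included in the induced convertibility.
    Conversely, on clash-free proper terms the relation is included in
    [step_ss], and (ess) decomposes into micro steps that replace the occurrences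
    of the variable one by one and then erase the cut.  Confluence thus transfers
    to both relations. *)

(* Mutual induction principles *)
Scheme mvalue_mind := Induction for mvalue Sort Prop
with evalue_mind := Induction for evalue Sort Prop
with value_mind := Induction for value Sort Prop
with term_mind := Induction for term Sort Prop.
Combined Scheme syntax_ind from mvalue_mind, evalue_mind, value_mind, term_mind.

Scheme vctx_mind := Induction for vctx Sort Prop
with ctx_mind := Induction for ctx Sort Prop.
Combined Scheme contexts_ind from vctx_mind, ctx_mind.

(** * Renamings *)

Definition idr : ren := fun _ i => i.

Ltac ext_ren := apply functional_extensionality; intros [];
  apply functional_extensionality; intros []; cbn; try reflexivity.

Lemma up_id k : up k idr = idr.
Proof. destruct k; ext_ren. Qed.

Lemma up_rcomp k r2 r1 : rcomp (up k r2) (up k r1) = up k (rcomp r2 r1).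
Proof. destruct k; ext_ren. Qed.

Lemma up_wk k r : rcomp (up k r) (wk k) = rcomp (wk k) r.
Proof. destruct k; ext_ren. Qed.

Lemma up_wk2 k1 k2 r :
  rcomp (up k2 (up k1 r)) (rcomp (wk k2) (wk k1)) =
  rcomp (rcomp (wk k2) (wk k1)) r.
Proof. destruct k1, k2; ext_ren. Qed.

Lemma ren_id :
  (forall v, ren_m idr v = v) /\ (forall v, ren_e idr v = v) /\
  (forall v, ren_v idr v = v) /\ (forall t, ren_t idr t = t).
Proof.
  apply syntax_ind; intros; cbn; rewrite ?up_id; f_equal; auto.
Qed.

Lemma ren_t_id t : ren_t idr t = t.
Proof. apply ren_id. Qed.

Lemma ren_ren :
  (forall v r2 r1, ren_m r2 (ren_m r1 v) = ren_m (rcomp r2 r1) v) /\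
  (forall v r2 r1, ren_e r2 (ren_e r1 v) = ren_e (rcomp r2 r1) v) /\
  (forall v r2 r1, ren_v r2 (ren_v r1 v) = ren_v (rcomp r2 r1) v) /\
  (forall t r2 r1, ren_t r2 (ren_t r1 t) = ren_t (rcomp r2 r1) t).
Proof.
  apply syntax_ind; intros; cbn; rewrite <- ?up_rcomp; f_equal; auto.
Qed.

Lemma ren_m_ren v r2 r1 : ren_m r2 (ren_m r1 v) = ren_m (rcomp r2 r1) v.
Proof. apply ren_ren. Qed.

Lemma ren_e_ren v r2 r1 : ren_e r2 (ren_e r1 v) = ren_e (rcomp r2 r1) v.
Proof. apply ren_ren. Qed.

Lemma ren_v_ren v r2 r1 : ren_v r2 (ren_v r1 v) = ren_v (rcomp r2 r1) v.
Proof. apply ren_ren. Qed.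

Lemma ren_t_ren t r2 r1 : ren_t r2 (ren_t r1 t) = ren_t (rcomp r2 r1) t.
Proof. apply ren_ren. Qed.

(** * Grafting on the value of a term *)

(* Common generalization of [cut_at] and [sub_at]: replaces the value [v] of
   [s = L<v>] by [F r v], where [r] is the weakening by the binders of [L]. *)
Definition graft (s : term) (F : ren -> value -> term) : term :=
  let (L, v) := split s in plug_l L (F (shift (nb_l L)) v).

Definition fcut (k : kind) (t : term) : ren -> value -> term :=
  fun r v => Cut v k (ren_t (up k r) t).

Definition fsub (m : nat) (k : kind) (t : term) : ren -> value -> term :=
  fun r v => Sub (r Mul m) v k (ren_t (up k r) t).

Lemma cut_at_graft s k t : cut_at s k t = graft s (fcut k t).
Proof. reflexivity. Qed.

Lemma sub_at_graft m s k t : sub_at m s k t = graft s (fsub m k t).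
Proof. reflexivity. Qed.

(** With these equations [graft] can be treated by induction on [s]: each binder crossed precomposes
    [F] with one weakening. *)
Lemma graft_val v F : graft (Val v) F = F idr v.
Proof. reflexivity. Qed.

Ltac solve_graft :=
  unfold graft; cbn; destruct (split _) as [L v]; cbn; do 3 f_equal;
  repeat (apply functional_extensionality; intro); unfold wk, shift, rcomp; lia.

Lemma graft_cut w j s F :
  graft (Cut w j s) F = Cut w j (graft s (fun r => F (rcomp r (wk j)))).
Proof. solve_graft. Qed.

Lemma graft_par m j1 j2 s F :
  graft (Par m j1 j2 s) F =
  Par m j1 j2 (graft s (fun r => F (rcomp r (rcomp (wk j2) (wk j1))))).
Proof. solve_graft. Qed.

Lemma graft_sub m w j s F :
  graft (Sub m w j s) F = Sub m w j (graft s (fun r => F (rcomp r (wk j)))).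
Proof. solve_graft. Qed.

Lemma graft_der e j s F :
  graft (Der e j s) F = Der e j (graft s (fun r => F (rcomp r (wk j)))).
Proof. solve_graft. Qed.

(** What [F] adds around the value lives outside [L] and is reached only through [r]; hence a
    renaming acts on the two arguments of [F] alone. *)
Definition natural (F : ren -> value -> term) : Prop :=
  forall r' r v, ren_t r' (F r v) = F (rcomp r' r) (ren_v r' v).

Lemma natural_fcut k t : natural (fcut k t).
Proof.
  intros r' r v; unfold fcut; cbn; now rewrite ren_t_ren, up_rcomp.
Qed.

Lemma natural_fsub m k t : natural (fsub m k t).
Proof.
  intros r' r v; unfold fsub; cbn; now rewrite ren_t_ren, up_rcomp.
Qed.

Lemma natural_pre F r0 : natural F -> natural (fun r => F (rcomp r r0)).
Proof. intros H r' r v; exact (H r' (rcomp r r0) v). Qed.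

Lemma ren_graft s : forall r' F, natural F ->
  ren_t r' (graft s F) = graft (ren_t r' s) (fun r => F (rcomp r r')).
Proof.
  induction s; intros r' F HF; cbn;
    rewrite ?graft_val, ?graft_cut, ?graft_par, ?graft_sub, ?graft_der.
  - exact (HF r' idr v).
  - cbn; f_equal. rewrite IHs by now apply natural_pre.
    f_equal; apply functional_extensionality; intro r.
    change (F (rcomp r (rcomp (up k r') (wk k))) = F (rcomp r (rcomp (wk k) r'))).
    now rewrite up_wk.
  - cbn; f_equal. rewrite IHs by now apply natural_pre.
    f_equal; apply functional_extensionality; intro r.
    change (F (rcomp r (rcomp (up k2 (up k1 r')) (rcomp (wk k2) (wk k1))))
      = F (rcomp r (rcomp (rcomp (wk k2) (wk k1)) r'))).
    now rewrite up_wk2.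
  - cbn; f_equal. rewrite IHs by now apply natural_pre.
    f_equal; apply functional_extensionality; intro r.
    change (F (rcomp r (rcomp (up k r') (wk k))) = F (rcomp r (rcomp (wk k) r'))).
    now rewrite up_wk.
  - cbn; f_equal. rewrite IHs by now apply natural_pre.
    f_equal; apply functional_extensionality; intro r.
    change (F (rcomp r (rcomp (up k r') (wk k))) = F (rcomp r (rcomp (wk k) r'))).
    now rewrite up_wk.
Qed.

Lemma fcut_ren k t r' : (fun r => fcut k t (rcomp r r')) = fcut k (ren_t (up k r') t).
Proof.
  apply functional_extensionality; intro r; apply functional_extensionality; intro v.
  unfold fcut; now rewrite ren_t_ren, up_rcomp.
Qed.

Lemma ren_cut_at r s k t :
  ren_t r (cut_at s k t) = cut_at (ren_t r s) k (ren_t (up k r) t).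
Proof.
  rewrite !cut_at_graft, ren_graft by apply natural_fcut. now rewrite fcut_ren.
Qed.

Lemma cut_at_val v k t : cut_at (Val v) k t = Cut v k t.
Proof.
  rewrite cut_at_graft, graft_val; unfold fcut; now rewrite up_id, ren_t_id.
Qed.

Lemma sub_at_val m v k t : sub_at m (Val v) k t = Sub m v k t.
Proof.
  rewrite sub_at_graft, graft_val; unfold fsub; now rewrite up_id, ren_t_id.
Qed.

(** The value of [graft s G] is found inside the grafted term [G r v], so a second graft continues
    from there. *)
Lemma graft_graft s : forall G F,
  graft (graft s G) F =
  graft s (fun r v => graft (G r v) (fun r' => F (rcomp r' r))).
Proof.
  induction s; intros G F;
    rewrite ?graft_val, ?graft_cut, ?graft_par, ?graft_sub, ?graft_der;
    [reflexivity | f_equal; apply IHs ..].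
Qed.

(** The value of a cut is the value of its body, so the graft moves into [t]. Naturality absorbs the
    weakening of [t] by the binders of [s]. *)
Lemma graft_cut_at s k t F : natural F ->
  graft (cut_at s k t) F = cut_at s k (graft t (fun r => F (rcomp r (wk k)))).
Proof.
  intro HF; rewrite !cut_at_graft, graft_graft; f_equal.
  apply functional_extensionality; intro r; apply functional_extensionality; intro v.
  unfold fcut; rewrite graft_cut, ren_graft by now apply natural_pre.
  do 2 f_equal; apply functional_extensionality; intro r'.
  change (F (rcomp r' (rcomp (wk k) r)) = F (rcomp r' (rcomp (up k r) (wk k)))).
  now rewrite up_wk.
Qed.

Lemma graft_sub_at m s k t F : natural F ->
  graft (sub_at m s k t) F = sub_at m s k (graft t (fun r => F (rcomp r (wk k)))).
Proof.
  intro HF; rewrite !sub_at_graft, graft_graft; f_equal.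
  apply functional_extensionality; intro r; apply functional_extensionality; intro v.
  unfold fsub; rewrite graft_sub, ren_graft by now apply natural_pre.
  do 2 f_equal; apply functional_extensionality; intro r'.
  change (F (rcomp r' (rcomp (wk k) r)) = F (rcomp r' (rcomp (up k r) (wk k)))).
  now rewrite up_wk.
Qed.

(** * Composition of contexts *)

Lemma shift_add n m : shift (fun k => n k + m k) = rcomp (shift m) (shift n).
Proof.
  unfold shift, rcomp; apply functional_extensionality; intro.
  apply functional_extensionality; intro; lia.
Qed.

Lemma graft_plug_l L : forall t F,
  graft (plug_l L t) F = plug_l L (graft t (fun r => F (rcomp r (shift (nb_l L))))).
Proof.
  induction L; intros t F; cbn [plug_l nb_l];
    rewrite ?graft_cut, ?graft_par, ?graft_sub, ?graft_der, ?IHL; [reflexivity | ..];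
    rewrite !shift_add; reflexivity.
Qed.

Lemma fsub_ren m k t r' :
  (fun r => fsub m k t (rcomp r r')) = fsub (r' Mul m) k (ren_t (up k r') t).
Proof.
  apply functional_extensionality; intro r; apply functional_extensionality; intro v.
  unfold fsub; now rewrite ren_t_ren, up_rcomp.
Qed.

(** The grammar puts a cut or a sub only on a value context. On any other context the new frame
    moves inwards, into the body of the existing cut or sub or under the left context, and the
    result is again a context. *)
Lemma plug_graft : forall C F,
  (exists k t, F = fcut k t) \/ (exists m k t, F = fsub m k t) ->
  exists C', forall x, plug C' x = graft (plug C x) F.
Proof.
  assert (N : forall F, (exists k t, F = fcut k t) \/ (exists m k t, F = fsub m k t) ->
    natural F)
    by (intros F [(k & t & ->) | (m & k & t & ->)];
        [apply natural_fcut | apply natural_fsub]).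
  fix IH 1; intros [V | V j s | m V j s | L C] F HF; cbn.
  - destruct HF as [(k & t & ->) | (m & k & t & ->)].
    + now exists (CCut V k t).
    + now exists (CSub m V k t).
  - eexists (CCut V j _); intro x; cbn; symmetry; apply graft_cut_at; auto.
  - eexists (CSub m V j _); intro x; cbn; symmetry; apply graft_sub_at; auto.
  - destruct (IH C (fun r => F (rcomp r (shift (nb_l L))))) as (C' & E).
    + destruct HF as [(k & t & ->) | (m & k & t & ->)];
        [rewrite fcut_ren; left | rewrite fsub_ren; right]; repeat eexists.
    + exists (CLeft L C'); intro x; cbn; now rewrite graft_plug_l, E.
Qed.

Lemma plug_plug :
  (forall V C, exists C', forall x, plug C' x = plug_v V (plug C x)) /\
  (forall C1 C, exists C', forall x, plug C' x = plug C1 (plug C x)).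
Proof.
  apply contexts_ind.
  - intro C; now exists C.
  - intros C1 IH s C; destruct (IH C) as (C' & E).
    exists (CVal (VPairL C' s)); intro x; cbn; now rewrite E.
  - intros s C1 IH C; destruct (IH C) as (C' & E).
    exists (CVal (VPairR s C')); intro x; cbn; now rewrite E.
  - intros k C1 IH C; destruct (IH C) as (C' & E).
    exists (CVal (VLam k C')); intro x; cbn; now rewrite E.
  - intros C1 IH C; destruct (IH C) as (C' & E).
    exists (CVal (VBang C')); intro x; cbn; now rewrite E.
  - trivial.
  - intros V IH k t C; destruct (IH C) as (C' & E).
    destruct (plug_graft C' (fcut k t)) as (C'' & E'); [eauto |].
    exists C''; intro x; now rewrite E', E.
  - intros m V IH k t C; destruct (IH C) as (C' & E).
    destruct (plug_graft C' (fsub m k t)) as (C'' & E'); [eauto |].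
    exists C''; intro x; now rewrite E', E.
  - intros L C1 IH C; destruct (IH C) as (C' & E).
    exists (CLeft L C'); intro x; cbn; now rewrite E.
Qed.

(** * Substitution of values of both kinds *)

(* The results of substituting a value for [m] in [par(m,..)] and [sub(m,..)],
   and for [e] in [der(e,..)].  On a clash, the cut is kept as it is. *)
Definition par_with (v : mvalue) (k1 k2 : kind) (t : term) : term :=
  match v with
  | MVar n => Par n k1 k2 t
  | Pair s u => cut_at s k1 (cut_at (ren_t (wk k1) u) k2 t)
  | Lam k s => Cut (VM v) Mul (Par 0 k1 k2 (ren_t (up k2 (up k1 (wk Mul))) t))
  end.

Definition sub_with (v : mvalue) (w : value) (k : kind) (t : term) : term :=
  match v with
  | MVar n => Sub n w k t
  | Pair s u => Cut (VM v) Mul (Sub 0 (ren_v (wk Mul) w) k (ren_t (up k (wk Mul)) t))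
  | Lam k' s => Cut w k' (cut_at s k (ren_t (up k (wk k')) t))
  end.

Definition der_with (v : evalue) (k : kind) (t : term) : term :=
  match v with
  | EVar e => Der e k t
  | Bang s => cut_at s k t
  end.

Record subst := Subst { sm : nat -> mvalue; se : nat -> evalue }.

Definition of_ren (r : ren) : subst :=
  Subst (fun i => MVar (r Mul i)) (fun i => EVar (r Exp i)).

Definition upS (k : kind) (f : subst) : subst :=
  Subst
    (fun i => match k, i with
       | Mul, 0 => MVar 0
       | Mul, S j => ren_m (wk Mul) (sm f j)
       | Exp, _ => ren_m (wk Exp) (sm f i)
       end)
    (up_s k (se f)).

Fixpoint subst_m (f : subst) (v : mvalue) : mvalue :=
  match v with
  | MVar m => sm f m
  | Pair t s => Pair (subst_t f t) (subst_t f s)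
  | Lam k t => Lam k (subst_t (upS k f) t)
  end
with subst_e (f : subst) (v : evalue) : evalue :=
  match v with
  | EVar e => se f e
  | Bang t => Bang (subst_t f t)
  end
with subst_v (f : subst) (v : value) : value :=
  match v with
  | VM v => VM (subst_m f v)
  | VE v => VE (subst_e f v)
  end
with subst_t (f : subst) (t : term) : term :=
  match t with
  | Val v => Val (subst_v f v)
  | Cut v k t => Cut (subst_v f v) k (subst_t (upS k f) t)
  | Par m k1 k2 t => par_with (sm f m) k1 k2 (subst_t (upS k2 (upS k1 f)) t)
  | Sub m v k t => sub_with (sm f m) (subst_v f v) k (subst_t (upS k f) t)
  | Der e k t => der_with (se f e) k (subst_t (upS k f) t)
  end.

Definition ren_after (r : ren) (f : subst) : subst :=
  Subst (fun i => ren_m r (sm f i)) (fun i => ren_e r (se f i)).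

Definition after_ren (f : subst) (r : ren) : subst :=
  Subst (fun i => sm f (r Mul i)) (fun i => se f (r Exp i)).

Definition scomp (g f : subst) : subst :=
  Subst (fun i => subst_m g (sm f i)) (fun i => subst_e g (se f i)).

Definition inst (v : value) : subst :=
  match v with
  | VM v => Subst (fun i => match i with 0 => v | S j => MVar j end) EVar
  | VE v => Subst MVar (inst_exp v)
  end.

Ltac ext_subst :=
  unfold upS, ren_after, after_ren, of_ren, scomp, inst; cbn; f_equal;
  apply functional_extensionality; intros []; cbn.

Lemma upS_of_ren k r : upS k (of_ren r) = of_ren (up k r).
Proof. destruct k; ext_subst; reflexivity. Qed.

Lemma of_ren_subst :
  (forall v r, subst_m (of_ren r) v = ren_m r v) /\
  (forall v r, subst_e (of_ren r) v = ren_e r v) /\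
  (forall v r, subst_v (of_ren r) v = ren_v r v) /\
  (forall t r, subst_t (of_ren r) t = ren_t r t).
Proof.
  apply syntax_ind; intros; cbn; rewrite ?upS_of_ren; f_equal; auto.
Qed.

Lemma of_ren_t t r : subst_t (of_ren r) t = ren_t r t.
Proof. apply of_ren_subst. Qed.

Lemma subst_t_id t : subst_t (of_ren idr) t = t.
Proof. rewrite of_ren_t. apply ren_t_id. Qed.

Lemma upS_after_ren k f r : after_ren (upS k f) (up k r) = upS k (after_ren f r).
Proof. destruct k; ext_subst; reflexivity. Qed.

Lemma upS_after_wk k f : after_ren (upS k f) (wk k) = ren_after (wk k) f.
Proof. destruct k; ext_subst; reflexivity. Qed.

Lemma subst_ren :
  (forall v f r, subst_m f (ren_m r v) = subst_m (after_ren f r) v) /\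
  (forall v f r, subst_e f (ren_e r v) = subst_e (after_ren f r) v) /\
  (forall v f r, subst_v f (ren_v r v) = subst_v (after_ren f r) v) /\
  (forall t f r, subst_t f (ren_t r t) = subst_t (after_ren f r) t).
Proof.
  apply syntax_ind; intros; cbn; rewrite <- ?upS_after_ren; f_equal; auto.
Qed.

Lemma subst_m_ren v f r : subst_m f (ren_m r v) = subst_m (after_ren f r) v.
Proof. apply subst_ren. Qed.

Lemma subst_e_ren v f r : subst_e f (ren_e r v) = subst_e (after_ren f r) v.
Proof. apply subst_ren. Qed.

Lemma subst_v_ren v f r : subst_v f (ren_v r v) = subst_v (after_ren f r) v.
Proof. apply subst_ren. Qed.

Lemma subst_t_ren t f r : subst_t f (ren_t r t) = subst_t (after_ren f r) t.
Proof. apply subst_ren. Qed.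

Lemma ren_par_with r v k1 k2 t :
  ren_t r (par_with v k1 k2 t) =
  par_with (ren_m r v) k1 k2 (ren_t (up k2 (up k1 r)) t).
Proof.
  destruct v; cbn; [reflexivity | |].
  - rewrite !ren_cut_at, !ren_t_ren, up_wk; reflexivity.
  - now rewrite !ren_t_ren, !up_rcomp, up_wk.
Qed.

Lemma ren_sub_with r v w k t :
  ren_t r (sub_with v w k t) = sub_with (ren_m r v) (ren_v r w) k (ren_t (up k r) t).
Proof.
  destruct v; cbn; [reflexivity | |].
  - rewrite !ren_t_ren, !ren_v_ren, !up_rcomp, up_wk; reflexivity.
  - now rewrite !ren_cut_at, !ren_t_ren, !up_rcomp, up_wk.
Qed.

Lemma ren_der_with r v k t :
  ren_t r (der_with v k t) = der_with (ren_e r v) k (ren_t (up k r) t).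
Proof. destruct v; cbn; [reflexivity | apply ren_cut_at]. Qed.

Lemma upS_ren_after k f r : ren_after (up k r) (upS k f) = upS k (ren_after r f).
Proof.
  destruct k; ext_subst; rewrite ?ren_m_ren, ?ren_e_ren, ?up_wk; reflexivity.
Qed.

Lemma ren_subst :
  (forall v f r, ren_m r (subst_m f v) = subst_m (ren_after r f) v) /\
  (forall v f r, ren_e r (subst_e f v) = subst_e (ren_after r f) v) /\
  (forall v f r, ren_v r (subst_v f v) = subst_v (ren_after r f) v) /\
  (forall t f r, ren_t r (subst_t f t) = subst_t (ren_after r f) t).
Proof.
  apply syntax_ind; intros; cbn;
    rewrite ?ren_par_with, ?ren_sub_with, ?ren_der_with, <- ?upS_ren_after;
    f_equal; auto.
Qed.

Lemma ren_t_subst t f r : ren_t r (subst_t f t) = subst_t (ren_after r f) t.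
Proof. apply ren_subst. Qed.

Lemma graft_par_with v k1 k2 t F : natural F ->
  graft (par_with v k1 k2 t) F =
  par_with v k1 k2 (graft t (fun r => F (rcomp r (rcomp (wk k2) (wk k1))))).
Proof.
  intro HF; destruct v; cbn.
  - apply graft_par.
  - rewrite graft_cut_at by assumption.
    rewrite graft_cut_at by now apply natural_pre. reflexivity.
  - rewrite graft_cut, graft_par, ren_graft by now apply natural_pre.
    do 3 f_equal; apply functional_extensionality; intro r.
    change (F (rcomp r (rcomp (rcomp (wk k2) (wk k1)) (wk Mul))) =
      F (rcomp r (rcomp (up k2 (up k1 (wk Mul))) (rcomp (wk k2) (wk k1))))).
    now rewrite up_wk2.
Qed.

Lemma graft_sub_with v w k t F : natural F ->
  graft (sub_with v w k t) F = sub_with v w k (graft t (fun r => F (rcomp r (wk k)))).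
Proof.
  intro HF; destruct v; cbn.
  - apply graft_sub.
  - rewrite graft_cut, graft_sub, ren_graft by now apply natural_pre.
    do 3 f_equal; apply functional_extensionality; intro r.
    change (F (rcomp r (rcomp (wk k) (wk Mul))) =
      F (rcomp r (rcomp (up k (wk Mul)) (wk k)))).
    now rewrite up_wk.
  - rewrite graft_cut, graft_cut_at, ren_graft by now apply natural_pre.
    do 3 f_equal; apply functional_extensionality; intro r.
    change (F (rcomp r (rcomp (wk k) (wk k0))) =
      F (rcomp r (rcomp (up k (wk k0)) (wk k)))).
    now rewrite up_wk.
Qed.

Lemma graft_der_with v k t F : natural F ->
  graft (der_with v k t) F = der_with v k (graft t (fun r => F (rcomp r (wk k)))).
Proof.
  intro HF; destruct v; cbn; [apply graft_der | now apply graft_cut_at].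
Qed.

(* [G] is the image of [F] under [f]: whenever [r] and [r'] weaken the source
   and the target of [f] to those of [g], then [g] maps [F r] to [G r']. *)
Definition image (f : subst) (F G : ren -> value -> term) : Prop :=
  forall g r r', after_ren g r = ren_after r' f ->
  forall v, subst_t g (F r v) = G r' (subst_v g v).

Lemma image_up k f F G :
  image f F G ->
  image (upS k f) (fun r => F (rcomp r (wk k))) (fun r => G (rcomp r (wk k))).
Proof.
  intros H g r r' E v; apply H.
  change (after_ren (after_ren g r) (wk k) = ren_after (rcomp r' (wk k)) f).
  rewrite E. change (ren_after r' (after_ren (upS k f) (wk k)) =
    ren_after (rcomp r' (wk k)) f).
  rewrite upS_after_wk; unfold ren_after; cbn.
  f_equal; apply functional_extensionality; intro; [apply ren_m_ren | apply ren_e_ren].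
Qed.

(** The substitution may turn [Par], [Sub] and [Der] nodes of [s] into cuts on other terms, and the
    graft has to be pushed through those; this is where [G] must be natural. *)
Lemma subst_graft s : forall f F G, natural G -> image f F G ->
  subst_t f (graft s F) = graft (subst_t f s) G.
Proof.
  induction s; intros f F G HG HF; cbn;
    rewrite ?graft_val, ?graft_cut, ?graft_par, ?graft_sub, ?graft_der,
      ?graft_par_with, ?graft_sub_with, ?graft_der_with by assumption; cbn.
  - apply HF. unfold ren_after, after_ren; cbn.
    f_equal; apply functional_extensionality; intro; symmetry; apply ren_id.
  - f_equal; apply IHs; [now apply natural_pre | now apply image_up].
  - f_equal; apply IHs; [now apply natural_pre |].
    exact (image_up _ _ _ _ (image_up _ _ _ _ HF)).
  - f_equal; apply IHs; [now apply natural_pre | now apply image_up].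
  - f_equal; apply IHs; [now apply natural_pre | now apply image_up].
Qed.

Lemma subst_up_ren g f r r' k t : after_ren g r = ren_after r' f ->
  subst_t (upS k g) (ren_t (up k r) t) = ren_t (up k r') (subst_t (upS k f) t).
Proof.
  intro E; rewrite subst_t_ren, ren_t_subst, upS_after_ren, upS_ren_after; now rewrite E.
Qed.

Lemma image_fcut f k t : image f (fcut k t) (fcut k (subst_t (upS k f) t)).
Proof.
  intros g r r' E v; unfold fcut; cbn; f_equal; now apply subst_up_ren.
Qed.

(** The family [fsub] is not closed under substitution, since the variable [m] may become a pair or
    an abstraction; this family is. *)
Definition fsub_with (v : mvalue) (k : kind) (t : term) : ren -> value -> term :=
  fun r w => sub_with (ren_m r v) w k (ren_t (up k r) t).

Lemma natural_fsub_with v k t : natural (fsub_with v k t).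
Proof.
  intros r' r w; unfold fsub_with.
  now rewrite ren_sub_with, ren_m_ren, ren_t_ren, up_rcomp.
Qed.

Lemma image_fsub f m k t :
  image f (fsub m k t) (fsub_with (sm f m) k (subst_t (upS k f) t)).
Proof.
  intros g r r' E v; unfold fsub, fsub_with; cbn.
  rewrite (subst_up_ren _ _ _ _ _ _ E). f_equal.
  change (sm (after_ren g r) m = ren_m r' (sm f m)). now rewrite E.
Qed.

Lemma subst_cut_at f s k t :
  subst_t f (cut_at s k t) = cut_at (subst_t f s) k (subst_t (upS k f) t).
Proof.
  rewrite !cut_at_graft. apply subst_graft; [apply natural_fcut | apply image_fcut].
Qed.

Lemma subst_sub_at f m s k t :
  subst_t f (sub_at m s k t) =
  graft (subst_t f s) (fsub_with (sm f m) k (subst_t (upS k f) t)).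
Proof.
  rewrite !sub_at_graft. apply subst_graft; [apply natural_fsub_with | apply image_fsub].
Qed.

Lemma subst_wk g k t : subst_t (upS k g) (ren_t (wk k) t) = ren_t (wk k) (subst_t g t).
Proof. now rewrite subst_t_ren, ren_t_subst, upS_after_wk. Qed.

Lemma subst_v_wk g k t : subst_v (upS k g) (ren_v (wk k) t) = ren_v (wk k) (subst_v g t).
Proof. rewrite subst_v_ren, upS_after_wk. symmetry; apply ren_subst. Qed.

Lemma subst_par_with g v k1 k2 t :
  subst_t g (par_with v k1 k2 t) =
  par_with (subst_m g v) k1 k2 (subst_t (upS k2 (upS k1 g)) t).
Proof.
  destruct v; cbn; [reflexivity | |].
  - now rewrite !subst_cut_at, subst_wk.
  - do 2 f_equal. apply subst_up_ren.
    rewrite upS_after_ren, upS_after_wk. symmetry; apply upS_ren_after.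
Qed.

Lemma subst_sub_with g v w k t :
  subst_t g (sub_with v w k t) =
  sub_with (subst_m g v) (subst_v g w) k (subst_t (upS k g) t).
Proof.
  destruct v; cbn; [reflexivity | |].
  - rewrite subst_v_wk. do 2 f_equal. apply subst_up_ren, upS_after_wk.
  - rewrite subst_cut_at. do 2 f_equal. apply subst_up_ren, upS_after_wk.
Qed.

Lemma subst_der_with g v k t :
  subst_t g (der_with v k t) = der_with (subst_e g v) k (subst_t (upS k g) t).
Proof. destruct v; cbn; [reflexivity | apply subst_cut_at]. Qed.

Lemma upS_scomp k g f : scomp (upS k g) (upS k f) = upS k (scomp g f).
Proof.
  destruct k; ext_subst; try reflexivity;
    rewrite ?subst_m_ren, ?subst_e_ren, ?upS_after_wk; symmetry; apply ren_subst.
Qed.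

Lemma subst_subst :
  (forall v g f, subst_m g (subst_m f v) = subst_m (scomp g f) v) /\
  (forall v g f, subst_e g (subst_e f v) = subst_e (scomp g f) v) /\
  (forall v g f, subst_v g (subst_v f v) = subst_v (scomp g f) v) /\
  (forall t g f, subst_t g (subst_t f t) = subst_t (scomp g f) t).
Proof.
  apply syntax_ind; intros; cbn;
    rewrite ?subst_par_with, ?subst_sub_with, ?subst_der_with, <- ?upS_scomp;
    f_equal; auto.
Qed.

Lemma inst_wk v : after_ren (inst v) (wk (kind_of v)) = of_ren idr.
Proof. destruct v; ext_subst; reflexivity. Qed.

Lemma subst_m_inst_wk v w : subst_m (inst v) (ren_m (wk (kind_of v)) w) = w.
Proof.
  rewrite subst_m_ren, inst_wk, (proj1 of_ren_subst). apply ren_id.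
Qed.

Lemma subst_e_inst_wk v w : subst_e (inst v) (ren_e (wk (kind_of v)) w) = w.
Proof.
  rewrite subst_e_ren, inst_wk, (proj1 (proj2 of_ren_subst)). apply ren_id.
Qed.

Lemma subst_t_inst_wk v t : subst_t (inst v) (ren_t (wk (kind_of v)) t) = t.
Proof. rewrite subst_t_ren, inst_wk. apply subst_t_id. Qed.

(** The substitution lemma: by [subst_subst] each side is a single substitution, and the two are
    compared variable by variable. *)
Lemma subst_inst v k t g : kind_of v = k ->
  subst_t g (subst_t (inst v) t) = subst_t (inst (subst_v g v)) (subst_t (upS k g) t).
Proof.
  intro E; rewrite !(proj2 (proj2 (proj2 subst_subst))). f_equal.
  destruct v as [v|v]; cbn in E; subst k; ext_subst; try reflexivity; symmetry;
    solve [ exact (subst_m_inst_wk (VM (subst_m g v)) _)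
          | exact (subst_e_inst_wk (VM (subst_m g v)) _)
          | exact (subst_m_inst_wk (VE (subst_e g v)) _)
          | exact (subst_e_inst_wk (VE (subst_e g v)) _) ].
Qed.

Lemma ren_inst v k t r : kind_of v = k ->
  ren_t r (subst_t (inst v) t) = subst_t (inst (ren_v r v)) (ren_t (up k r) t).
Proof.
  intro E; rewrite <- !of_ren_t, (subst_inst _ _ _ _ E).
  now rewrite upS_of_ren, (proj1 (proj2 (proj2 of_ren_subst))).
Qed.

(** * Parallel reduction *)

(** Values reduce through [Val], which keeps the relation single instead of mutual. Only cuts of
    matching kinds fire: the interactions with [Par], [Sub] and [Der] are left to the
    substitution. *)
Inductive par : term -> term -> Prop :=
| par_mvar m : par (Val (VM (MVar m))) (Val (VM (MVar m)))
| par_pair t t' s s' :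
    par t t' -> par s s' -> par (Val (VM (Pair t s))) (Val (VM (Pair t' s')))
| par_lam k t t' : par t t' -> par (Val (VM (Lam k t))) (Val (VM (Lam k t')))
| par_evar e : par (Val (VE (EVar e))) (Val (VE (EVar e)))
| par_bang t t' : par t t' -> par (Val (VE (Bang t))) (Val (VE (Bang t')))
| par_cut v v' k t t' :
    par (Val v) (Val v') -> par t t' -> par (Cut v k t) (Cut v' k t')
| par_beta v v' k t t' :
    kind_of v = k -> par (Val v) (Val v') -> par t t' ->
    par (Cut v k t) (subst_t (inst v') t')
| par_par m k1 k2 t t' : par t t' -> par (Par m k1 k2 t) (Par m k1 k2 t')
| par_sub m v v' k t t' :
    par (Val v) (Val v') -> par t t' -> par (Sub m v k t) (Sub m v' k t')
| par_der e k t t' : par t t' -> par (Der e k t) (Der e k t').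

Lemma par_refl :
  (forall v, par (Val (VM v)) (Val (VM v))) /\
  (forall v, par (Val (VE v)) (Val (VE v))) /\
  (forall v, par (Val v) (Val v)) /\
  (forall t, par t t).
Proof. apply syntax_ind; intros; try constructor; auto. Qed.

Lemma par_t_refl t : par t t.
Proof. apply par_refl. Qed.

Lemma par_kind v v' : par (Val v) (Val v') -> kind_of v' = kind_of v.
Proof. inversion 1; reflexivity. Qed.

Lemma par_ren t t' : par t t' -> forall r, par (ren_t r t) (ren_t r t').
Proof.
  induction 1; intro r; cbn; try (constructor; cbn in *; now auto).
  rewrite (ren_inst v' k) by (rewrite (par_kind _ _ H0); assumption).
  apply par_beta; [destruct v; assumption | apply IHpar1 | apply IHpar2].
Qed.

(** The counterpart of [natural] for a substitution that acts as a renaming on the image of [r]. *)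
Definition stable (F : ren -> value -> term) : Prop := image (of_ren idr) F F.

Lemma stable_pre F r0 : stable F -> stable (fun r => F (rcomp r r0)).
Proof.
  intros H g r r' E v; apply H.
  change (after_ren (after_ren g r) r0 = after_ren (ren_after r' (of_ren idr)) r0).
  now rewrite E.
Qed.

Lemma image_inst v F : stable F ->
  image (inst v) (fun r => F (rcomp r (wk (kind_of v)))) F.
Proof.
  intros H g r r' E w; apply H.
  change (after_ren (after_ren g r) (wk (kind_of v)) = of_ren r').
  rewrite E. change (ren_after r' (after_ren (inst v) (wk (kind_of v))) = of_ren r').
  now rewrite inst_wk.
Qed.

Lemma stable_fcut k t : stable (fcut k t).
Proof.
  intros g r r' E v. rewrite (image_fcut (of_ren idr) k t g r r' E).
  now rewrite upS_of_ren, up_id, subst_t_id.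
Qed.

Lemma stable_fsub_with v k t : stable (fsub_with v k t).
Proof.
  intros g r r' E w. unfold fsub_with.
  rewrite subst_sub_with, subst_m_ren, subst_t_ren, upS_after_ren, E.
  change (ren_after r' (of_ren idr)) with (of_ren r').
  rewrite upS_of_ren, of_ren_t.
  now rewrite (proj1 of_ren_subst).
Qed.

Lemma par_graft s s' : par s s' -> forall F F',
  natural F' -> stable F' ->
  (forall r v v', par (Val v) (Val v') -> par (F r v) (F' r v')) ->
  par (graft s F) (graft s' F').
Proof.
  induction 1; intros F F' N S HF;
    rewrite ?graft_val, ?graft_cut, ?graft_par, ?graft_sub, ?graft_der;
    try (apply HF; constructor; assumption);
    try (constructor; try assumption;
      match goal with IH : forall F F', _ |- _ => apply IH end;
      [now apply natural_pre | now apply stable_pre | intros; now apply HF]).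
  assert (E : kind_of v' = k) by (rewrite (par_kind _ _ H0); assumption).
  (* The cut that fires lies in [s], and its binder also scopes over the grafted material. That
     material does not use the bound variable, so firing commutes with the graft. *)
  rewrite <- (subst_graft t' (inst v') (fun r => F' (rcomp r (wk k))) F').
  - apply par_beta; try assumption. apply IHpar2;
      [now apply natural_pre | now apply stable_pre | intros; now apply HF].
  - assumption.
  - rewrite <- E; now apply image_inst.
Qed.

Lemma par_cut_at s s' k t t' : par s s' -> par t t' -> par (cut_at s k t) (cut_at s' k t').
Proof.
  intros Hs Ht; rewrite !cut_at_graft; apply par_graft; trivial.
  - apply natural_fcut.
  - apply stable_fcut.
  - intros r v v' Hv; constructor; [assumption | now apply par_ren].
Qed.

Lemma par_par_with v v' k1 k2 t t' :
  par (Val (VM v)) (Val (VM v')) -> par t t' ->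
  par (par_with v k1 k2 t) (par_with v' k1 k2 t').
Proof.
  inversion 1; subst; intro Ht; cbn.
  - now constructor.
  - apply par_cut_at; [assumption |]. apply par_cut_at; [now apply par_ren | assumption].
  - repeat (constructor; try assumption). now apply par_ren.
Qed.

Lemma par_sub_with v v' w w' k t t' :
  par (Val (VM v)) (Val (VM v')) -> par (Val w) (Val w') -> par t t' ->
  par (sub_with v w k t) (sub_with v' w' k t').
Proof.
  inversion 1; subst; intros Hw Ht; cbn.
  - now constructor.
  - repeat (constructor; try assumption); [exact (par_ren _ _ Hw _) | now apply par_ren].
  - constructor; [assumption |]. apply par_cut_at; [assumption | now apply par_ren].
Qed.

Lemma par_der_with v v' k t t' :
  par (Val (VE v)) (Val (VE v')) -> par t t' ->
  par (der_with v k t) (der_with v' k t').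
Proof.
  inversion 1; subst; intros Ht; cbn; [now constructor | now apply par_cut_at].
Qed.

Lemma par_sub_at m s s' k t : par s s' -> par (sub_at m s k t) (sub_at m s' k t).
Proof.
  (* The two families are convertible, and stability is known for [fsub_with]. *)
  intros Hs. change (par (graft s (fsub_with (MVar m) k t)) (graft s' (fsub_with (MVar m) k t))).
  apply par_graft; trivial.
  - apply natural_fsub_with.
  - apply stable_fsub_with.
  - intros r v v' Hv. apply par_sub_with; [constructor | assumption | apply par_t_refl].
Qed.

Definition par_subst (f f' : subst) : Prop :=
  (forall i, par (Val (VM (sm f i))) (Val (VM (sm f' i)))) /\
  (forall i, par (Val (VE (se f i))) (Val (VE (se f' i)))).

Lemma par_subst_up k f f' : par_subst f f' -> par_subst (upS k f) (upS k f').
Proof.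
  intros [Hm He].
  assert (Hm' : forall i,
    par (Val (VM (ren_m (wk k) (sm f i)))) (Val (VM (ren_m (wk k) (sm f' i)))))
    by (intro i; exact (par_ren _ _ (Hm i) (wk k))).
  assert (He' : forall i,
    par (Val (VE (ren_e (wk k) (se f i)))) (Val (VE (ren_e (wk k) (se f' i)))))
    by (intro i; exact (par_ren _ _ (He i) (wk k))).
  split; intro i; destruct k; cbn; auto; destruct i; auto; apply par_t_refl.
Qed.

Lemma par_subst_t t t' : par t t' -> forall f f', par_subst f f' ->
  par (subst_t f t) (subst_t f' t').
Proof.
  induction 1; intros f f' Hf; cbn; try apply Hf;
    try (constructor; try apply IHpar1; try apply IHpar2; try apply IHpar;
      repeat apply par_subst_up; assumption).
  - rewrite (subst_inst v' k) by (rewrite (par_kind _ _ H0); assumption).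
    apply par_beta; [destruct v; assumption | apply IHpar1, Hf |].
    now apply IHpar2, par_subst_up.
  - apply par_par_with; [apply Hf |]. now apply IHpar; repeat apply par_subst_up.
  - apply par_sub_with; [apply Hf | apply IHpar1, Hf |]. now apply IHpar2, par_subst_up.
  - apply par_der_with; [apply Hf |]. now apply IHpar, par_subst_up.
Qed.

Lemma par_subst_inst v v' : par (Val v) (Val v') -> par_subst (inst v) (inst v').
Proof.
  intro H; split; intro i; inversion H; subst; cbn; destruct i; trivial; constructor.
Qed.

(** * Complete developments and confluence of parallel reduction *)

Definition kind_eq_dec (k k' : kind) : {k = k'} + {k <> k'}.
Proof. decide equality. Defined.

(** Complete development: all cuts of matching kinds present in the term fire at once, but not those
    that this creates. *)
Fixpoint dev_m (v : mvalue) : mvalue :=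
  match v with
  | MVar m => MVar m
  | Pair t s => Pair (dev t) (dev s)
  | Lam k t => Lam k (dev t)
  end
with dev_e (v : evalue) : evalue :=
  match v with
  | EVar e => EVar e
  | Bang t => Bang (dev t)
  end
with dev_v (v : value) : value :=
  match v with
  | VM v => VM (dev_m v)
  | VE v => VE (dev_e v)
  end
with dev (t : term) : term :=
  match t with
  | Val v => Val (dev_v v)
  | Cut v k t =>
      if kind_eq_dec (kind_of v) k then subst_t (inst (dev_v v)) (dev t)
      else Cut (dev_v v) k (dev t)
  | Par m k1 k2 t => Par m k1 k2 (dev t)
  | Sub m v k t => Sub m (dev_v v) k (dev t)
  | Der e k t => Der e k (dev t)
  end.

(** The triangle property: whatever a parallel step has left unfired can be fired in one further
    parallel step. It yields the diamond property with [dev t] as the common reduct. *)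
Lemma par_dev t t' : par t t' -> par t' (dev t).
Proof.
  induction 1; cbn in *; try (constructor; assumption).
  - destruct (kind_eq_dec (kind_of v) k) as [E | E]; [| now constructor].
    constructor; trivial. now rewrite (par_kind _ _ H).
  - destruct (kind_eq_dec (kind_of v) k) as [_ | E]; [| contradiction].
    apply par_subst_t; [assumption | now apply par_subst_inst].
Qed.

Definition joinable (t s : term) : Prop := exists u, steps par t u /\ steps par s u.

Lemma par_strip t s u : par t s -> steps par t u ->
  exists w, steps par s w /\ par u w.
Proof.
  intros H1 H2; revert s H1; apply clos_rt_rt1n in H2.
  induction H2 as [t | t t' u Ht _ IH]; intros s H1.
  - exists s; split; [apply rt_refl | assumption].
  - destruct (IH (dev t) (par_dev _ _ Ht)) as (w & Hw1 & Hw2).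
    exists w; split; [| assumption].
    eapply rt_trans; [apply rt_step, par_dev, H1 | assumption].
Qed.

Lemma par_confluent t s u : steps par t s -> steps par t u -> joinable s u.
Proof.
  intros H1; revert u; apply clos_rt_rt1n in H1.
  induction H1 as [t | t t' s Ht _ IH]; intros u H2.
  - exists u; split; [assumption | apply rt_refl].
  - destruct (par_strip _ _ _ Ht H2) as (w & Hw1 & Hw2).
    destruct (IH w Hw1) as (x & Hx1 & Hx2).
    exists x; split; [assumption | eapply rt_trans; [apply rt_step, Hw2 | assumption]].
Qed.

(** Confluence closes the peak at [s]. Joinability is thereby the convertibility generated by
    [par]. *)
Lemma joinable_trans t s u : joinable t s -> joinable s u -> joinable t u.
Proof.
  intros (w1 & H1 & H2) (w2 & H3 & H4).
  destruct (par_confluent _ _ _ H2 H3) as (w & H5 & H6).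
  exists w; split; eapply rt_trans; eassumption.
Qed.

Lemma par_plug_l L t t' : par t t' -> par (plug_l L t) (plug_l L t').
Proof.
  intro H; induction L; cbn; trivial; constructor; trivial; apply par_t_refl.
Qed.

Lemma par_plug t t' : par t t' ->
  (forall V, par (plug_v V t) (plug_v V t')) /\
  (forall C, par (plug C t) (plug C t')).
Proof.
  intro H; apply contexts_ind; intros; cbn; trivial;
    try (constructor; trivial; apply par_t_refl).
  - apply par_cut_at; [assumption | apply par_t_refl].
  - now apply par_sub_at.
  - now apply par_plug_l.
Qed.

(** * Occurrences *)

(* Sum of the weights [W] of the free occurrences of variables; [occ m] is the
   case of the weight [delta Mul m]. *)
Definition weight := kind -> nat -> nat.

Definition upw (k : kind) (W : weight) : weight := fun k' i =>
  match one k k', i with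
  | 0, _ => W k' i
  | S _, 0 => 0
  | S _, S j => W k' j
  end.

Fixpoint wocc_m (W : weight) (v : mvalue) : nat :=
  match v with
  | MVar m => W Mul m
  | Pair t s => wocc W t + wocc W s
  | Lam k t => wocc (upw k W) t
  end
with wocc_e (W : weight) (v : evalue) : nat :=
  match v with
  | EVar e => W Exp e
  | Bang t => wocc W t
  end
with wocc_v (W : weight) (v : value) : nat :=
  match v with
  | VM v => wocc_m W v
  | VE v => wocc_e W v
  end
with wocc (W : weight) (t : term) : nat :=
  match t with
  | Val v => wocc_v W v
  | Cut v k t => wocc_v W v + wocc (upw k W) t
  | Par m k1 k2 t => W Mul m + wocc (upw k2 (upw k1 W)) t
  | Sub m v k t => W Mul m + (wocc_v W v + wocc (upw k W) t)
  | Der e k t => W Exp e + wocc (upw k W) t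
  end.

Definition delta (k : kind) (i : nat) : weight := fun k' j =>
  if kind_eq_dec k k' then if i =? j then 1 else 0 else 0.

Definition wzero : weight := fun _ _ => 0.

Definition wren (W : weight) (r : ren) : weight := fun k i => W k (r k i).

Lemma upw_delta k k' i : upw k (delta k' i) = delta k' (wk k k' i).
Proof. destruct k, k'; ext_ren. Qed.

Lemma upw_wren k W r : wren (upw k W) (up k r) = upw k (wren W r).
Proof. destruct k; ext_ren. Qed.

Lemma upw_wk k W : wren (upw k W) (wk k) = W.
Proof. destruct k; ext_ren. Qed.

Lemma upw_wzero k : upw k wzero = wzero.
Proof. destruct k; ext_ren. Qed.

Lemma wren_delta_wk k : wren (delta k 0) (wk k) = wzero.
Proof. destruct k; ext_ren. Qed.

Lemma wren_delta_up k r : wren (delta k 0) (up k r) = delta k 0.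
Proof. destruct k; ext_ren. Qed.

Lemma occ_wocc :
  (forall v m, occ_m m v = wocc_m (delta Mul m) v) /\
  (forall v m, occ_e m v = wocc_e (delta Mul m) v) /\
  (forall v m, occ_v m v = wocc_v (delta Mul m) v) /\
  (forall t m, occ m t = wocc (delta Mul m) t).
Proof.
  apply syntax_ind; intros; cbn; rewrite ?upw_delta; auto.
Qed.

Lemma occ_t_wocc t m : occ m t = wocc (delta Mul m) t.
Proof. apply occ_wocc. Qed.

Lemma wocc_ren :
  (forall v W r, wocc_m W (ren_m r v) = wocc_m (wren W r) v) /\
  (forall v W r, wocc_e W (ren_e r v) = wocc_e (wren W r) v) /\
  (forall v W r, wocc_v W (ren_v r v) = wocc_v (wren W r) v) /\
  (forall t W r, wocc W (ren_t r t) = wocc (wren W r) t).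
Proof.
  apply syntax_ind; intros; cbn; rewrite <- ?upw_wren; auto.
Qed.

Lemma wocc_m_ren v W r : wocc_m W (ren_m r v) = wocc_m (wren W r) v.
Proof. apply wocc_ren. Qed.

Lemma wocc_e_ren v W r : wocc_e W (ren_e r v) = wocc_e (wren W r) v.
Proof. apply wocc_ren. Qed.

Lemma wocc_v_ren v W r : wocc_v W (ren_v r v) = wocc_v (wren W r) v.
Proof. apply wocc_ren. Qed.

Lemma wocc_t_ren t W r : wocc W (ren_t r t) = wocc (wren W r) t.
Proof. apply wocc_ren. Qed.

Lemma wocc_zero :
  (forall v, wocc_m wzero v = 0) /\ (forall v, wocc_e wzero v = 0) /\
  (forall v, wocc_v wzero v = 0) /\ (forall t, wocc wzero t = 0).
Proof.
  apply syntax_ind; intros; cbn; rewrite ?upw_wzero; auto;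
    rewrite ?H, ?H0; reflexivity.
Qed.

Lemma wocc_t_zero t : wocc wzero t = 0.
Proof. apply wocc_zero. Qed.

(** Occurrence counts are linear in the weight. With [a] the count in a value [v], this computes the
    count in the result of substituting [v] for a variable. *)
Definition wlin (a : nat) (W W' : weight) : weight := fun k i => a * W k i + W' k i.

Lemma upw_wlin k a W W' : upw k (wlin a W W') = wlin a (upw k W) (upw k W').
Proof. unfold wlin; destruct k; ext_ren; lia. Qed.

Lemma wocc_lin :
  (forall v a W W', wocc_m (wlin a W W') v = a * wocc_m W v + wocc_m W' v) /\
  (forall v a W W', wocc_e (wlin a W W') v = a * wocc_e W v + wocc_e W' v) /\
  (forall v a W W', wocc_v (wlin a W W') v = a * wocc_v W v + wocc_v W' v) /\
  (forall t a W W', wocc (wlin a W W') t = a * wocc W t + wocc W' t).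
Proof.
  apply syntax_ind; intros; cbn; rewrite ?upw_wlin, ?H, ?H0; auto; unfold wlin; lia.
Qed.

Lemma wocc_t_lin t a W W' : wocc (wlin a W W') t = a * wocc W t + wocc W' t.
Proof. apply wocc_lin. Qed.

Lemma delta_same k i : delta k i k i = 1.
Proof.
  unfold delta; destruct (kind_eq_dec k k); [| contradiction]. now rewrite Nat.eqb_refl.
Qed.

(** Agreement on the free variables of a piece of syntax, given by its counting function [o]: the
    weight [delta k i] isolates one variable. *)
Definition agree {A} (f g : kind -> nat -> A) (o : weight -> nat) : Prop :=
  forall k i, f k i = g k i \/ o (delta k i) = 0.

Lemma agree_sub {A} (f g : kind -> nat -> A) (o o' : weight -> nat) :
  agree f g o -> (forall d, o' d <= o d) -> agree f g o'.
Proof.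
  intros H L k i; destruct (H k i); auto; right. specialize (L (delta k i)); lia.
Qed.

Lemma agree_var {A} (f g : kind -> nat -> A) k i o :
  agree f g o -> (forall d, d k i <= o d) -> f k i = g k i.
Proof.
  intros H L; destruct (H k i) as [E | E]; trivial.
  specialize (L (delta k i)); rewrite delta_same in L; lia.
Qed.

Lemma agree_upw k W W' o :
  agree W W' (fun d => o (upw k d)) -> agree (upw k W) (upw k W') o.
Proof.
  intros H k' i; destruct k, k', i; cbn; auto;
    match goal with |- W ?k ?i = _ \/ _ => specialize (H k i) end;
    cbn in H; rewrite upw_delta in H; exact H.
Qed.

Lemma agree_up k r r' o :
  agree r r' (fun d => o (upw k d)) -> agree (up k r) (up k r') o.
Proof.
  intros H k' i; destruct k, k', i; cbn; auto;
    match goal with |- context [r ?k ?i] => specialize (H k i) end;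
    cbn in H; rewrite upw_delta in H; destruct H; auto.
Qed.

Ltac agree_tac :=
  match goal with
  | IH : context [agree _ _ _ -> _] |- _ =>
      apply IH; repeat (apply agree_upw || apply agree_up);
      match goal with H : agree _ _ _ |- agree _ _ _ =>
        apply (agree_sub _ _ _ _ H); intro; cbn; lia end
  | H : agree _ _ _ |- _ => apply (agree_var _ _ _ _ _ H); intro; cbn; lia
  end.

Lemma wocc_agree :
  (forall v W W', agree W W' (fun d => wocc_m d v) -> wocc_m W v = wocc_m W' v) /\
  (forall v W W', agree W W' (fun d => wocc_e d v) -> wocc_e W v = wocc_e W' v) /\
  (forall v W W', agree W W' (fun d => wocc_v d v) -> wocc_v W v = wocc_v W' v) /\
  (forall t W W', agree W W' (fun d => wocc d t) -> wocc W t = wocc W' t).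
Proof.
  apply syntax_ind; intros; cbn;
    repeat match goal with |- _ + _ = _ + _ => f_equal end; agree_tac.
Qed.

Lemma ren_agree :
  (forall v r r', agree r r' (fun d => wocc_m d v) -> ren_m r v = ren_m r' v) /\
  (forall v r r', agree r r' (fun d => wocc_e d v) -> ren_e r v = ren_e r' v) /\
  (forall v r r', agree r r' (fun d => wocc_v d v) -> ren_v r v = ren_v r' v) /\
  (forall t r r', agree r r' (fun d => wocc d t) -> ren_t r t = ren_t r' t).
Proof.
  apply syntax_ind; intros; cbn; f_equal; agree_tac.
Qed.

Lemma unused_wk k t : wocc (delta k 0) t = 0 -> exists t', t = ren_t (wk k) t'.
Proof.
  intro H.
  (* A left inverse of the weakening. Weakening after it moves only the index 0 of kind [k], which
     does not occur in [t]. *)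
  set (r := (fun k' i => if kind_eq_dec k k' then pred i else i) : ren).
  exists (ren_t r t). rewrite ren_t_ren, <- (ren_t_id t) at 1.
  apply ren_agree; intros k' i; unfold r, idr, rcomp.
  destruct k, k', i; cbn; auto.
Qed.

(** Here [w] measures what [F] adds beside the value, as seen from outside the binders of [s]. *)
Lemma wocc_graft (w : weight -> nat) s : forall W F,
  (forall W r v, wocc W (F r v) = wocc_v W v + w (wren W r)) ->
  wocc W (graft s F) = wocc W s + w W.
Proof.
  assert (P : forall F r0 (w : weight -> nat),
    (forall W r v, wocc W (F r v) = wocc_v W v + w (wren W r)) ->
    (forall W r v, wocc W (F (rcomp r r0) v) = wocc_v W v + w (wren (wren W r) r0)))
    by (intros F r0 w' H W r v; exact (H W (rcomp r r0) v)).
  revert w; induction s; intros w W F HF;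
    rewrite ?graft_val, ?graft_cut, ?graft_par, ?graft_sub, ?graft_der; cbn.
  - apply HF.
  - rewrite (IHs (fun W => w (wren W (wk k)))) by (apply P, HF). rewrite upw_wk; lia.
  - rewrite (IHs (fun W => w (wren W (rcomp (wk k2) (wk k1))))) by (apply P, HF).
    change (wren (upw k2 (upw k1 W)) (rcomp (wk k2) (wk k1)))
      with (wren (wren (upw k2 (upw k1 W)) (wk k2)) (wk k1)).
    rewrite !upw_wk; lia.
  - rewrite (IHs (fun W => w (wren W (wk k)))) by (apply P, HF). rewrite upw_wk; lia.
  - rewrite (IHs (fun W => w (wren W (wk k)))) by (apply P, HF). rewrite upw_wk; lia.
Qed.

Lemma wocc_cut_at W s k t : wocc W (cut_at s k t) = wocc W s + wocc (upw k W) t.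
Proof.
  rewrite cut_at_graft. apply (wocc_graft (fun W => wocc (upw k W) t)).
  intros; unfold fcut; cbn. now rewrite wocc_t_ren, upw_wren.
Qed.

Lemma wocc_sub_at W m s k t :
  wocc W (sub_at m s k t) = wocc W s + (W Mul m + wocc (upw k W) t).
Proof.
  rewrite sub_at_graft. apply (wocc_graft (fun W => W Mul m + wocc (upw k W) t)).
  intros; unfold fsub; cbn. rewrite wocc_t_ren, upw_wren; unfold wren; lia.
Qed.

(** An interaction keeps every piece exactly once, and so does the cut rebuilt on a clash;
    substitution therefore affects counts only through the weights of variables. *)
Lemma wocc_par_with W v k1 k2 t :
  wocc W (par_with v k1 k2 t) = wocc_m W v + wocc (upw k2 (upw k1 W)) t.
Proof.
  destruct v; cbn; trivial.
  - rewrite !wocc_cut_at, wocc_t_ren, upw_wk; lia.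
  - now rewrite wocc_t_ren, !upw_wren, upw_wk.
Qed.

Lemma wocc_sub_with W v w k t :
  wocc W (sub_with v w k t) = wocc_m W v + (wocc_v W w + wocc (upw k W) t).
Proof.
  destruct v; cbn; trivial.
  - now rewrite wocc_v_ren, wocc_t_ren, !upw_wren, (upw_wk Mul W : wren (upw Mul W) (wk Mul) = W).
  - rewrite wocc_cut_at, wocc_t_ren, upw_wren, upw_wk; lia.
Qed.

Lemma wocc_der_with W v k t :
  wocc W (der_with v k t) = wocc_e W v + wocc (upw k W) t.
Proof. destruct v; cbn; trivial. apply wocc_cut_at. Qed.

Definition wsubst (W : weight) (f : subst) : weight := fun k i =>
  match k with Mul => wocc_m W (sm f i) | Exp => wocc_e W (se f i) end.

Lemma upw_wsubst k W f : wsubst (upw k W) (upS k f) = upw k (wsubst W f).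
Proof.
  destruct k; ext_ren; rewrite ?wocc_m_ren, ?wocc_e_ren;
    (rewrite (upw_wk Mul W) || rewrite (upw_wk Exp W)); reflexivity.
Qed.

Lemma wocc_subst :
  (forall v W f, wocc_m W (subst_m f v) = wocc_m (wsubst W f) v) /\
  (forall v W f, wocc_e W (subst_e f v) = wocc_e (wsubst W f) v) /\
  (forall v W f, wocc_v W (subst_v f v) = wocc_v (wsubst W f) v) /\
  (forall t W f, wocc W (subst_t f t) = wocc (wsubst W f) t).
Proof.
  apply syntax_ind; intros; cbn;
    rewrite ?wocc_par_with, ?wocc_sub_with, ?wocc_der_with, <- ?upw_wsubst; auto.
Qed.

Lemma wocc_t_subst t W f : wocc W (subst_t f t) = wocc (wsubst W f) t.
Proof. apply wocc_subst. Qed.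

(** * Properness *)

Lemma binds_linearly_wocc k t :
  binds_linearly k t <-> (k = Mul -> wocc (delta Mul 0) t = 1).
Proof.
  rewrite <- occ_t_wocc; destruct k; cbn; intuition discriminate.
Qed.

Lemma proper_par m k1 k2 t :
  proper (Par m k1 k2 t) <->
  (k1 = Mul -> wocc (upw k2 (delta Mul 0)) t = 1) /\ binds_linearly k2 t /\ proper t.
Proof.
  cbn; rewrite upw_delta, <- occ_t_wocc; destruct k1; intuition discriminate.
Qed.

Lemma binds_linearly_eq k t t' :
  wocc (delta Mul 0) t = wocc (delta Mul 0) t' -> binds_linearly k t <-> binds_linearly k t'.
Proof. intro E; now rewrite !binds_linearly_wocc, E. Qed.

Lemma closed_wocc t W :
  (forall m, occ m t = 0) -> (forall e, W Exp e = 0) -> wocc W t = 0.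
Proof.
  intros H HW; rewrite (proj2 (proj2 (proj2 wocc_agree)) t W wzero).
  - apply wocc_zero.
  - intros [] i; [right; now rewrite <- occ_t_wocc | left; apply HW].
Qed.

Lemma closed_ren t r : (forall m, occ m (ren_t r t) = 0) <-> (forall m, occ m t = 0).
Proof.
  split; intros H m; [specialize (H (r Mul m)) | rename m into i];
    rewrite occ_t_wocc, wocc_t_ren in *.
  (* The renaming may identify variables, so the pulled-back weight [W] only dominates
     [delta Mul m]. Hence the truncated subtraction below is exact, and linearity splits the
     count. *)
  - set (W := wren _ r) in H.
    assert (E : W = wlin 1 (delta Mul m) (fun k i => W k i - delta Mul m k i)).
    { unfold wlin; apply functional_extensionality; intro k.
      apply functional_extensionality; intro i.
      enough (delta Mul m k i <= W k i) by lia.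
      unfold W, wren, delta; destruct k; cbn; [| lia].
      destruct (Nat.eqb_spec m i); [subst; rewrite Nat.eqb_refl |]; lia. }
    rewrite E, wocc_t_lin in H; lia.
  - now apply closed_wocc.
Qed.

Lemma binds_linearly_ren k r t : binds_linearly k (ren_t (up k r) t) <-> binds_linearly k t.
Proof.
  rewrite !binds_linearly_wocc, wocc_t_ren. destruct k; [| intuition discriminate].
  now rewrite wren_delta_up.
Qed.

Lemma proper_ren :
  (forall v r, proper_m (ren_m r v) <-> proper_m v) /\
  (forall v r, proper_e (ren_e r v) <-> proper_e v) /\
  (forall v r, proper_v (ren_v r v) <-> proper_v v) /\
  (forall t r, proper (ren_t r t) <-> proper t).
Proof.
  apply syntax_ind; intros;
    try (cbn; rewrite ?closed_ren, ?binds_linearly_ren, ?H, ?H0; tauto).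
  cbn [ren_t]; rewrite !proper_par, binds_linearly_ren, H.
  assert (E : k1 = Mul -> wren (upw k2 (delta Mul 0)) (up k2 (up k1 r)) = upw k2 (delta Mul 0))
    by (intro; subst k1; now rewrite upw_wren, wren_delta_up).
  rewrite wocc_t_ren. destruct k1; [rewrite E by reflexivity |]; intuition discriminate.
Qed.

Lemma proper_t_ren t r : proper (ren_t r t) <-> proper t.
Proof. apply proper_ren. Qed.

(** The grafted material, whose count is [w] and whose own properness is [P], avoids the binders of
    [s], so the linearity conditions at these binders keep their counts. *)
Lemma proper_graft s : forall (w : weight -> nat) (P : Prop) F,
  (forall W r v, wocc W (F r v) = wocc_v W v + w (wren W r)) -> w wzero = 0 ->
  (forall r v, proper (F r v) <-> proper_v v /\ P) ->
  proper (graft s F) <-> proper s /\ P.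
Proof.
  assert (A : forall (w : weight -> nat) F,
    (forall W r v, wocc W (F r v) = wocc_v W v + w (wren W r)) ->
    forall r0 s W, wren W r0 = wzero -> w wzero = 0 ->
    wocc W (graft s (fun r => F (rcomp r r0))) = wocc W s).
  { intros w F HF r0 s' W E Hw.
    rewrite (wocc_graft (fun W => w (wren W r0))).
    - rewrite E, Hw; lia.
    - intros W' r v; exact (HF W' (rcomp r r0) v). }
  induction s; intros w P F HF Hw HP;
    rewrite ?graft_val, ?graft_cut, ?graft_par, ?graft_sub, ?graft_der;
  try match goal with |- context [graft s (fun r => F (rcomp r ?r0))] =>
    assert (E : proper (graft s (fun r => F (rcomp r r0))) <-> proper s /\ P)
      by (apply (IHs (fun W => w (wren W r0)) P);
          [intros W r v'; exact (HF W (rcomp r r0) v') | exact Hw | intros; apply HP]) end;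
  try match type of E with context [wk ?k] =>
    assert (B : binds_linearly k (graft s (fun r => F (rcomp r (wk k)))) <->
      binds_linearly k s)
      by (rewrite !binds_linearly_wocc; destruct k; [| intuition discriminate];
          rewrite (A w F HF); [tauto | apply wren_delta_wk | assumption]);
    cbn; rewrite E, B; tauto end.
  - apply HP.
  - rewrite !proper_par, E, !binds_linearly_wocc.
    assert (E1 : k1 = Mul -> wocc (upw k2 (delta Mul 0))
      (graft s (fun r => F (rcomp r (rcomp (wk k2) (wk k1))))) = wocc (upw k2 (delta Mul 0)) s).
    { intro; subst k1; apply (A w F HF); [| assumption].
      change (wren (wren (upw k2 (delta Mul 0)) (wk k2)) (wk Mul) = wzero).
      rewrite upw_wk; apply wren_delta_wk. }
    assert (E2 : k2 = Mul -> wocc (delta Mul 0)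
      (graft s (fun r => F (rcomp r (rcomp (wk k2) (wk k1))))) = wocc (delta Mul 0) s).
    { intro; subst k2; apply (A w F HF); [| assumption].
      change (wren (wren (delta Mul 0) (wk Mul)) (wk k1) = wzero).
      now rewrite wren_delta_wk. }
    destruct k1, k2; rewrite ?E1, ?E2 by reflexivity; intuition discriminate.
Qed.

Lemma proper_cut_at s k t :
  proper (cut_at s k t) <-> proper s /\ (binds_linearly k t /\ proper t).
Proof.
  rewrite cut_at_graft; apply (proper_graft s (fun W => wocc (upw k W) t)).
  - intros; unfold fcut; cbn. now rewrite wocc_t_ren, upw_wren.
  - rewrite upw_wzero; apply wocc_zero.
  - intros; unfold fcut; cbn. now rewrite binds_linearly_ren, proper_t_ren.
Qed.

Lemma proper_sub_at m s k t :
  proper (sub_at m s k t) <-> proper s /\ (binds_linearly k t /\ proper t).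
Proof.
  rewrite sub_at_graft; apply (proper_graft s (fun W => W Mul m + wocc (upw k W) t)).
  - intros; unfold fsub; cbn. rewrite wocc_t_ren, upw_wren; unfold wren; lia.
  - rewrite upw_wzero; apply wocc_zero.
  - intros; unfold fsub; cbn. now rewrite binds_linearly_ren, proper_t_ren.
Qed.

Lemma proper_par_with m v k1 k2 t :
  proper_m v -> proper (Par m k1 k2 t) -> proper (par_with v k1 k2 t).
Proof.
  rewrite proper_par; intros Hv (H1 & H2 & H3); destruct v; cbn in Hv |- *.
  - change (proper (Par m0 k1 k2 t)); rewrite proper_par; tauto.
  - rewrite !proper_cut_at, proper_t_ren, binds_linearly_wocc, wocc_cut_at.
    repeat split; try tauto. intro; subst k1.
    rewrite wocc_t_ren, wren_delta_wk, wocc_t_zero. now apply H1.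
  - set (q := ren_t _ t).
    change (proper_m (Lam k t0) /\ binds_linearly Mul (Par 0 k1 k2 q) /\ proper (Par 0 k1 k2 q)).
    rewrite proper_par, binds_linearly_wocc; unfold q; cbn -[proper_m].
    rewrite wocc_t_ren, !upw_wren, wren_delta_wk, !upw_wzero, binds_linearly_ren,
      wocc_t_zero, proper_t_ren.
    repeat split; try tauto. intro; subst k1.
    rewrite wocc_t_ren, upw_wren, wren_delta_up; now apply H1.
Qed.

Lemma proper_sub_with m v w k t :
  proper_m v -> proper (Sub m w k t) -> proper (sub_with v w k t).
Proof.
  cbn [proper]; intros Hv (H1 & H2 & H3); destruct v; cbn in Hv |- *.
  - tauto.
  - rewrite binds_linearly_ren, proper_t_ren, (proj1 (proj2 (proj2 proper_ren))).
    rewrite !occ_t_wocc, (proj1 (proj2 (proj2 occ_wocc))), wocc_v_ren, wocc_t_ren.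
    rewrite wren_delta_wk, (proj1 (proj2 (proj2 wocc_zero))).
    rewrite <- upw_delta, upw_wren, wren_delta_wk, upw_wzero.
    rewrite wocc_t_zero. tauto.
  - rewrite proper_cut_at, proper_t_ren, binds_linearly_ren.
    rewrite binds_linearly_wocc in Hv |- *. repeat split; try tauto.
    intro; subst k0. rewrite wocc_cut_at, wocc_t_ren, upw_wren, wren_delta_wk, upw_wzero,
      wocc_t_zero, (proj1 Hv); reflexivity.
Qed.

Lemma proper_der_with e v k t :
  proper_e v -> proper (Der e k t) -> proper (der_with v k t).
Proof.
  destruct v; cbn; trivial. rewrite proper_cut_at; tauto.
Qed.

Lemma proper_e_closed v m : proper_e v -> wocc_e (delta Mul m) v = 0.
Proof. destruct v; cbn; trivial. rewrite <- occ_t_wocc; intros [H _]; apply H. Qed.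

Definition proper_subst (f : subst) : Prop :=
  (forall i, proper_m (sm f i)) /\ (forall i, proper_e (se f i)).

Lemma proper_subst_up k f : proper_subst f -> proper_subst (upS k f).
Proof.
  intros [Hm He]; split; intro i; destruct k; cbn; [destruct i | | | destruct i];
    try exact I; apply proper_ren; auto.
Qed.

Lemma wsubst_delta_up f : wsubst (delta Mul 0) (upS Mul f) = delta Mul 0.
Proof.
  ext_ren; rewrite ?wocc_m_ren, ?wocc_e_ren, wren_delta_wk; apply wocc_zero.
Qed.

Lemma binds_linearly_subst k f t :
  binds_linearly k t -> binds_linearly k (subst_t (upS k f) t).
Proof.
  rewrite !binds_linearly_wocc, wocc_t_subst; destruct k.
  - now rewrite wsubst_delta_up.
  - discriminate.
Qed.

Lemma proper_subst_all :
  (forall v f, proper_subst f -> proper_m v -> proper_m (subst_m f v)) /\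
  (forall v f, proper_subst f -> proper_e v -> proper_e (subst_e f v)) /\
  (forall v f, proper_subst f -> proper_v v -> proper_v (subst_v f v)) /\
  (forall t f, proper_subst f -> proper t -> proper (subst_t f t)).
Proof.
  apply syntax_ind; intros; cbn [subst_m subst_e subst_v subst_t].
  - apply H.
  - destruct H2; split; auto.
  - destruct H1; split; [now apply binds_linearly_subst | auto using proper_subst_up].
  - apply H.
  (* No multiplicative variable occurs under the [!], so only exponential values are substituted
     there, and proper ones contain no free multiplicative variable. *)
  - destruct H1; split; [| auto]. intro m.
    rewrite occ_t_wocc, wocc_t_subst.
    apply closed_wocc; trivial. intro e; cbn; apply proper_e_closed, H0.
  - now apply H.
  - now apply H.
  - now apply H.
  - destruct H2 as (? & ? & ?); repeat split;
      auto using binds_linearly_subst, proper_subst_up.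
  - apply (proper_par_with m); [apply H0 |]. rewrite proper_par in *.
    destruct H1 as (H1 & H2 & H3); repeat split;
      auto using binds_linearly_subst, proper_subst_up.
    intro; subst k1. rewrite wocc_t_subst, upw_wsubst, wsubst_delta_up.
    auto.
  - apply (proper_sub_with m); [apply H1 |]. destruct H2 as (? & ? & ?); repeat split;
      auto using binds_linearly_subst, proper_subst_up.
  - apply (proper_der_with e); [apply H0 |]. destruct H1 as (? & ?); repeat split;
      auto using binds_linearly_subst, proper_subst_up.
Qed.

(** Counts of multiplicative variables are kept because a multiplicative value is copied exactly
    once, by linearity of its binder, while a proper exponential value contributes none, however
    often it is copied. *)
Lemma proper_inst v k t : kind_of v = k -> proper (Cut v k t) ->
  proper (subst_t (inst v) t) /\
  forall i, wocc (delta Mul i) (subst_t (inst v) t) = wocc (delta Mul i) (Cut v k t).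
Proof.
  intros E (Hv & Hb & Ht); split.
  - apply proper_subst_all; trivial. split; destruct v; intros []; cbn; trivial.
  - intro i; rewrite wocc_t_subst.
    rewrite binds_linearly_wocc in Hb. destruct v as [v | v]; cbn in E, Hv; subst k; cbn.
    + replace (wsubst _ _) with
        (wlin (wocc_m (delta Mul i) v) (delta Mul 0) (upw Mul (delta Mul i)))
        by (unfold wlin; ext_ren; lia).
      rewrite wocc_t_lin, Hb by reflexivity. lia.
    + rewrite (proper_e_closed v i Hv). cbn; f_equal.
      ext_ren; now apply proper_e_closed.
Qed.

(** * Replacing one occurrence of a variable *)

(* The rules other than [AxM2], [Weak] and [Ess] replace, under a context, an
   occurrence of the cut variable in this way. *)
Inductive fires (j : nat) : value -> term -> term -> Prop :=
| fires_mvar v : fires j (VM v) (Val (VM (MVar j))) (Val (VM v))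
| fires_par v k1 k2 t : fires j (VM v) (Par j k1 k2 t) (par_with v k1 k2 t)
| fires_sub v w k t : fires j (VM v) (Sub j w k t) (sub_with v w k t)
| fires_evar v : fires j (VE v) (Val (VE (EVar j))) (Val (VE v))
| fires_der v k t : fires j (VE v) (Der j k t) (der_with v k t).

Definition lookup (f : subst) (k : kind) (i : nat) : value :=
  match k with Mul => VM (sm f i) | Exp => VE (se f i) end.

(** Under [f] the variable [j] becomes the very value that fired, so the substitution performs in
    [x] the interaction already made in [y]. *)
Lemma subst_fires f j v x y : fires j v x y ->
  lookup f (kind_of v) j = subst_v f v -> subst_t f x = subst_t f y.
Proof.
  destruct 1; cbn; intro E; injection E as E; rewrite E; trivial; symmetry.
  - apply subst_par_with.
  - apply subst_sub_with.
  - apply subst_der_with.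
Qed.

Lemma wocc_fires W j v x y : fires j v x y ->
  wocc W x + wocc_v W v = wocc W y + W (kind_of v) j.
Proof.
  destruct 1; cbn; rewrite ?wocc_par_with, ?wocc_sub_with, ?wocc_der_with; lia.
Qed.

Lemma proper_fires j v x y : fires j v x y -> proper_v v -> proper x -> proper y.
Proof.
  destruct 1; cbn [proper_v]; trivial.
  - apply proper_par_with.
  - apply proper_sub_with.
  - apply proper_der_with.
Qed.

(** * Substitution under a context *)

Definition lifts (r : ren) (f g : subst) : Prop := after_ren g r = ren_after r f.

Lemma lifts_rcomp r s f g h : lifts s f h -> lifts r h g -> lifts (rcomp r s) f g.
Proof.
  unfold lifts; intros E2 E1.
  change (after_ren (after_ren g r) s = ren_after (rcomp r s) f).
  rewrite E1. change (ren_after r (after_ren h s) = ren_after (rcomp r s) f).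
  rewrite E2. unfold ren_after; cbn.
  f_equal; apply functional_extensionality; intro; [apply ren_m_ren | apply ren_e_ren].
Qed.

Lemma lifts_wk k f : lifts (wk k) f (upS k f).
Proof. apply upS_after_wk. Qed.

Lemma lifts_idr f : lifts idr f f.
Proof.
  unfold lifts, ren_after, after_ren; cbn.
  f_equal; apply functional_extensionality; intro; symmetry; apply ren_id.
Qed.

(** For a context [P] with [n k] binders of each kind [k] above the hole, [g] is what [f] becomes at
    the hole. It is left existential, since only its values on variables from outside [P] matter
    later. *)
Definition transfers (n : kind -> nat) (P : term -> term) : Prop :=
  forall f, exists g, lifts (shift n) f g /\
  forall x y, subst_t g x = subst_t g y -> subst_t f (P x) = subst_t f (P y).

Lemma transfers_comp n m P Q :
  transfers n P -> transfers m Q -> transfers (fun k => n k + m k) (fun x => P (Q x)).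
Proof.
  intros HP HQ f. destruct (HP f) as (h & Hh & Eh). destruct (HQ h) as (g & Hg & Eg).
  exists g; split; [rewrite shift_add; eapply lifts_rcomp; eassumption | auto].
Qed.

Lemma transfers_up k P :
  (forall f x y, subst_t (upS k f) x = subst_t (upS k f) y ->
    subst_t f (P x) = subst_t f (P y)) -> transfers (one k) P.
Proof. intros H f; exists (upS k f); split; [apply lifts_wk | auto]. Qed.

Lemma transfers_same P :
  (forall f x y, subst_t f x = subst_t f y -> subst_t f (P x) = subst_t f (P y)) ->
  transfers (fun _ => 0) P.
Proof. intros H f; exists f; split; [apply lifts_idr | auto]. Qed.

Lemma transfers_plug_l L : transfers (nb_l L) (plug_l L).
Proof.
  induction L.
  - apply transfers_same; auto.
  - apply (transfers_comp (one k) _ (Cut v k)); trivial.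
    apply transfers_up; intros f x y E; cbn; now rewrite E.
  - replace (nb_l (LPar m k1 k2 L)) with (fun k => (one k1 k + one k2 k) + nb_l L k)
      by (apply functional_extensionality; intro; cbn; lia).
    apply (transfers_comp _ _ (Par m k1 k2)); trivial.
    intro f; exists (upS k2 (upS k1 f)); split.
    + rewrite shift_add; eapply lifts_rcomp; apply lifts_wk.
    + intros x y E; cbn; now rewrite E.
  - apply (transfers_comp (one k) _ (Sub m v k)); trivial.
    apply transfers_up; intros f x y E; cbn; now rewrite E.
  - apply (transfers_comp (one k) _ (Der e k)); trivial.
    apply transfers_up; intros f x y E; cbn; now rewrite E.
Qed.

Lemma transfers_plug :
  (forall V, transfers (nb_v V) (plug_v V)) /\ (forall C, transfers (nb C) (plug C)).
Proof.
  apply contexts_ind.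
  - apply transfers_same; auto.
  - intros C HC s f; destruct (HC f) as (g & Hg & E); exists g; split; trivial.
    intros x y Exy; cbn; now rewrite (E x y Exy).
  - intros s C HC f; destruct (HC f) as (g & Hg & E); exists g; split; trivial.
    intros x y Exy; cbn; now rewrite (E x y Exy).
  - intros k C HC. apply (transfers_comp (one k) _ (fun t => Val (VM (Lam k t)))); trivial.
    apply transfers_up; intros f x y E; cbn; now rewrite E.
  - intros C HC f; destruct (HC f) as (g & Hg & E); exists g; split; trivial.
    intros x y Exy; cbn; now rewrite (E x y Exy).
  - trivial.
  - intros V HV k s f; destruct (HV f) as (g & Hg & E); exists g; split; trivial.
    intros x y Exy; cbn; now rewrite !subst_cut_at, (E x y Exy).
  - intros m V HV k s f; destruct (HV f) as (g & Hg & E); exists g; split; trivial.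
    intros x y Exy; cbn; now rewrite !subst_sub_at, (E x y Exy).
  - intros L C HC; apply (transfers_comp _ _ (plug_l L)); trivial. apply transfers_plug_l.
Qed.

(** At the hole, the cut variable is sent to [v] weakened by the binders of [C], and the weakened
    [v] that fires is sent to the same value. So the substitution cannot see whether one occurrence
    has been replaced beforehand. *)
Lemma subst_fires_plug C v x y :
  fires (nb C (kind_of v)) (ren_v (into (kind_of v) C) v) x y ->
  subst_t (inst v) (plug C x) = subst_t (inst v) (plug C y).
Proof.
  intro H. destruct (proj2 transfers_plug C (inst v)) as (g & Hg & E).
  apply E, (subst_fires g _ _ _ _ H). clear E H.
  rewrite subst_v_ren.
  change (after_ren g (into (kind_of v) C)) with
    (after_ren (after_ren g (shift (nb C))) (wk (kind_of v))).
  rewrite Hg.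
  change (after_ren (ren_after (shift (nb C)) (inst v)) (wk (kind_of v)))
    with (ren_after (shift (nb C)) (after_ren (inst v) (wk (kind_of v)))).
  rewrite inst_wk. change (ren_after (shift (nb C)) (of_ren idr)) with (of_ren (shift (nb C))).
  rewrite (proj1 (proj2 (proj2 of_ren_subst))).
  (* Outside [C] the cut variable has index 0, so its index [nb C] at the hole is a shifted 0. *)
  transitivity (lookup (after_ren g (shift (nb C))) (kind_of v) 0).
  - destruct v; cbn; unfold shift; now rewrite Nat.add_0_r.
  - rewrite Hg; destruct v; reflexivity.
Qed.

(** The count of the whole minus the count at the hole depends on the context only. Comparing two
    fillings by sums avoids truncated subtraction. *)
Lemma wocc_plug_l L : forall k i x y,
  wocc (delta k i) (plug_l L x) + wocc (delta k (nb_l L k + i)) y =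
  wocc (delta k i) (plug_l L y) + wocc (delta k (nb_l L k + i)) x.
Proof.
  induction L; intros j i x y; cbn; rewrite ?upw_delta; try lia.
  - specialize (IHL j (wk k j i) x y).
    replace (one k j + nb_l L j + i) with (nb_l L j + wk k j i)
      by (unfold wk, shift; lia). lia.
  - specialize (IHL j (wk k2 j (wk k1 j i)) x y).
    replace (one k1 j + (one k2 j + nb_l L j) + i) with (nb_l L j + wk k2 j (wk k1 j i))
      by (unfold wk, shift; lia). lia.
  - specialize (IHL j (wk k j i) x y).
    replace (one k j + nb_l L j + i) with (nb_l L j + wk k j i)
      by (unfold wk, shift; lia). lia.
  - specialize (IHL j (wk k j i) x y).
    replace (one k j + nb_l L j + i) with (nb_l L j + wk k j i)
      by (unfold wk, shift; lia). lia.
Qed.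

Lemma wocc_plug :
  (forall V k i x y,
    wocc (delta k i) (plug_v V x) + wocc (delta k (nb_v V k + i)) y =
    wocc (delta k i) (plug_v V y) + wocc (delta k (nb_v V k + i)) x) /\
  (forall C k i x y,
    wocc (delta k i) (plug C x) + wocc (delta k (nb C k + i)) y =
    wocc (delta k i) (plug C y) + wocc (delta k (nb C k + i)) x).
Proof.
  apply contexts_ind.
  - cbn; lia.
  - intros C H s j i x y; specialize (H j i x y); cbn; lia.
  - intros s C H j i x y; specialize (H j i x y); cbn; lia.
  - intros k C H j i x y; specialize (H j (wk k j i) x y); cbn; rewrite upw_delta.
    replace (one k j + nb C j + i) with (nb C j + wk k j i) by (unfold wk, shift; lia).
    lia.
  - intros C H j i x y; specialize (H j i x y); cbn; lia.
  - trivial.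
  - intros V H k s j i x y; specialize (H j i x y); cbn; rewrite !wocc_cut_at; lia.
  - intros m V H k s j i x y; specialize (H j i x y); cbn; rewrite !wocc_sub_at; lia.
  - intros L C H j i x y; cbn.
    pose proof (wocc_plug_l L j i (plug C x) (plug C y)).
    specialize (H j (nb_l L j + i) x y).
    replace (nb_l L j + nb C j + i) with (nb C j + (nb_l L j + i)) by lia. lia.
Qed.

Lemma wren_delta_into k C : wren (delta k (nb C k)) (into k C) = wzero.
Proof.
  apply functional_extensionality; intro k'; apply functional_extensionality; intro i.
  unfold wzero, wren, delta, into, rcomp, wk, shift.
  destruct (kind_eq_dec k k') as [<- |]; trivial.
  replace (one k k) with 1 by now destruct k.
  destruct (Nat.eqb_spec (nb C k) (nb C k + (1 + i))); lia.
Qed.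

(** The value comes from outside the cut: firing consumes one occurrence of the cut variable and
    brings in none. *)
Lemma wocc_fires_into C v x y : let k := kind_of v in
  fires (nb C k) (ren_v (into k C) v) x y ->
  wocc (delta k (nb C k)) x = S (wocc (delta k (nb C k)) y).
Proof.
  intros k H. pose proof (wocc_fires (delta k (nb C k)) _ _ _ _ H) as E.
  replace (kind_of (ren_v (into k C) v)) with k in E by now destruct v.
  rewrite delta_same, wocc_v_ren, wren_delta_into, (proj1 (proj2 (proj2 wocc_zero))) in E.
  lia.
Qed.

Lemma wocc_fires_plug C v x y : let k := kind_of v in
  fires (nb C k) (ren_v (into k C) v) x y ->
  wocc (delta k 0) (plug C x) = S (wocc (delta k 0) (plug C y)).
Proof.
  intros k H. pose proof (proj2 wocc_plug C k 0 x y) as E1; rewrite Nat.add_0_r in E1.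
  pose proof (wocc_fires_into C v x y H) as E2; cbn in E2; fold k in E2. lia.
Qed.

Lemma wocc_mul_plug C x y :
  (forall i, wocc (delta Mul i) x = wocc (delta Mul i) y) ->
  forall i, wocc (delta Mul i) (plug C x) = wocc (delta Mul i) (plug C y).
Proof.
  intros H i; pose proof (proj2 wocc_plug C Mul i x y) as E; rewrite H in E; lia.
Qed.

Lemma proper_plug_l L x y :
  (forall i, wocc (delta Mul i) x = wocc (delta Mul i) y) ->
  (proper x -> proper y) -> proper (plug_l L x) -> proper (plug_l L y).
Proof.
  intros H HP; induction L; trivial;
    assert (E : forall i, wocc (delta Mul i) (plug_l L x) = wocc (delta Mul i) (plug_l L y))
      by (intro i; pose proof (wocc_plug_l L Mul i x y) as E; rewrite H in E; lia).
  - cbn; rewrite (binds_linearly_eq _ _ _ (E 0)); tauto.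
  - cbn [plug_l]; rewrite !proper_par, upw_delta, E, (binds_linearly_eq _ _ _ (E 0)); tauto.
  - cbn; rewrite (binds_linearly_eq _ _ _ (E 0)); tauto.
  - cbn; rewrite (binds_linearly_eq _ _ _ (E 0)); tauto.
Qed.

Lemma proper_plug x y :
  (forall i, wocc (delta Mul i) x = wocc (delta Mul i) y) -> (proper x -> proper y) ->
  (forall V, proper (plug_v V x) -> proper (plug_v V y)) /\
  (forall C, proper (plug C x) -> proper (plug C y)).
Proof.
  intros H HP; apply contexts_ind; trivial.
  - cbn; tauto.
  - cbn; tauto.
  - intros k C HC; cbn.
    rewrite (binds_linearly_eq _ _ _ (wocc_mul_plug C _ _ H 0)); tauto.
  - intros C HC; cbn; intros [Hc Hp]; split; [| tauto].
    intro m; rewrite occ_t_wocc, <- (wocc_mul_plug C _ _ H), <- occ_t_wocc; apply Hc.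
  - intros V HV k t; cbn; rewrite !proper_cut_at; tauto.
  - intros m V HV k t; cbn; rewrite !proper_sub_at; tauto.
  - intros L C HC; cbn. apply proper_plug_l; trivial. now apply wocc_mul_plug.
Qed.

(** * Rules as substitutions *)

Lemma es_subst :
  (forall v f, es_m f v = subst_m (Subst MVar f) v) /\
  (forall v f, es_e f v = subst_e (Subst MVar f) v) /\
  (forall v f, es_v f v = subst_v (Subst MVar f) v) /\
  (forall t f, es_t f t = subst_t (Subst MVar f) t).
Proof.
  assert (E : forall k f, Subst MVar (up_s k f) = upS k (Subst MVar f))
    by (intros k f; unfold upS; cbn; f_equal;
      apply functional_extensionality; destruct k; intros []; reflexivity).
  apply syntax_ind; intros; cbn; rewrite <- ?E; unfold der_with; f_equal; auto.
  now rewrite H.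
Qed.

Lemma es_t_subst t f : es_t f t = subst_t (Subst MVar f) t.
Proof. apply es_subst. Qed.

(** The rules that erase their cut are single substitutions; the rules that keep it replace one
    occurrence of the variable. *)
Lemma root_cases a t s : root a t s ->
  (exists v b, t = Cut v (kind_of v) b /\ s = subst_t (inst v) b) \/
  (exists v C x y, t = Cut (VE v) Exp (plug C x) /\ s = Cut (VE v) Exp (plug C y) /\
    fires (nb C Exp) (ren_v (into Exp C) (VE v)) x y).
Proof.
  (* For the multiplicative rules: replacing the occurrence does not change the substituted body,
     and the body so obtained is [r] weakened, which the substitution sends back to [r]. *)
  assert (P : forall v M x y r,
    fires (nb M Mul) (VM (ren_m (into Mul M) v)) x y ->
    plug M y = ren_t (wk Mul) r -> r = subst_t (inst (VM v)) (plug M x)).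
  { intros v M x y r Hf E. rewrite (subst_fires_plug M (VM v) x y Hf), E.
    symmetry; exact (subst_t_inst_wk (VM v) r). }
  destruct 1 as [v M r _ E | n t | s u M k1 k2 t r _ E | k s M v k' t r _ E
    | v C | f C k t | s C k t | v t | v t].
  - left; exists (VM v); eexists; split; [reflexivity |]. eapply P; [| exact E]. constructor.
  - left; exists (VM (MVar n)); eexists; split; [reflexivity |].
    rewrite <- of_ren_t; f_equal.
    ext_subst; reflexivity.
  - left; exists (VM (Pair s u)); eexists; split; [reflexivity |]. eapply P; [| exact E].
    rewrite <- ren_t_ren; apply (fires_par _ (Pair _ _)).
  - left; exists (VM (Lam k s)); eexists; split; [reflexivity |]. eapply P; [| exact E].
    apply (fires_sub _ (Lam _ _)).
  - right; do 4 eexists; repeat split. constructor.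
  - right; do 4 eexists; repeat split. apply (fires_der _ (EVar _)).
  - right; do 4 eexists; repeat split. apply (fires_der _ (Bang _)).
  - left; exists (VE v); eexists; split; [reflexivity |].
    symmetry; exact (subst_t_inst_wk (VE v) t).
  - left; exists (VE v); eexists; split; [reflexivity | apply es_subst].
Qed.

Lemma root_joinable a t s : root a t s -> exists u, par t u /\ par s u.
Proof.
  intro H; destruct (root_cases _ _ _ H)
    as [(v & b & -> & ->) | (v & C & x & y & -> & -> & Hf)].
  - eexists; split; [apply par_beta; trivial |]; apply par_t_refl.
  (* The cut is present on both sides, and firing it gives the same term by [subst_fires_plug]. *)
  - exists (subst_t (inst (VE v)) (plug C x)); split.
    + apply par_beta; trivial; apply par_t_refl.
    + rewrite (subst_fires_plug C (VE v) x y Hf). apply par_beta; trivial; apply par_t_refl.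
Qed.

Lemma step_joinable a t s : step a t s -> joinable t s.
Proof.
  destruct 1 as [C t s H]. destruct (root_joinable _ _ _ H) as (u & H1 & H2).
  exists (plug C u); split; apply rt_step; now apply par_plug.
Qed.

(** Invariance of the multiplicative counts is what lets properness pass through the context in
    which the rule is applied. *)
Lemma root_proper a t s : root a t s -> proper t ->
  proper s /\ forall i, wocc (delta Mul i) s = wocc (delta Mul i) t.
Proof.
  intros H Ht; destruct (root_cases _ _ _ H)
    as [(v & b & -> & ->) | (v & C & x & y & -> & -> & Hf)].
  - now apply (proper_inst v (kind_of v)).
  - assert (Hv : proper_e (ren_e (into Exp C) v)) by (apply proper_ren, Ht).
    assert (E : forall i, wocc (delta Mul i) x = wocc (delta Mul i) y).
    { intro i; pose proof (wocc_fires (delta Mul i) _ _ _ _ Hf) as E.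
      cbn [kind_of ren_v wocc_v] in E. rewrite (proper_e_closed _ i Hv) in E.
      change (delta Mul i Exp _) with 0 in E. lia. }
    split.
    + destruct Ht as (H1 & _ & H2); repeat split; trivial.
      apply (proper_plug x y); trivial. now apply (proper_fires _ _ _ _ Hf).
    + intro i; cbn; rewrite upw_delta. now rewrite (wocc_mul_plug C x y E).
Qed.

Lemma proper_plug_inv t :
  (forall V, proper (plug_v V t) -> proper t) /\ (forall C, proper (plug C t) -> proper t).
Proof.
  apply contexts_ind; trivial; try (cbn; tauto).
  - intros V H k s; cbn; rewrite proper_cut_at; tauto.
  - intros m V H k s; cbn; rewrite proper_sub_at; tauto.
  - intros L C H; cbn; intro HL; apply H; clear H.
    induction L; trivial; apply IHL; cbn in HL; tauto.
Qed.

Lemma step_proper a t s : step a t s -> proper t -> proper s.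
Proof.
  destruct 1 as [C t s H]; intro HC.
  destruct (root_proper _ _ _ H (proj2 (proper_plug_inv t) C HC)) as [Hs E].
  apply (proper_plug t s); trivial; intro; symmetry; apply E.
Qed.

(** * Substitutions as rules *)

Lemma step_plug a C t s : step a t s -> step a (plug C t) (plug C s).
Proof.
  destruct 1 as [C0 t s H]. destruct (proj2 plug_plug C C0) as (C' & E).
  rewrite <- !E; now apply step_ctx.
Qed.

Lemma step_root a t s : root a t s -> step a t s.
Proof. exact (step_ctx a (CVal VHole) t s). Qed.

Definition rule_ms (a : rule) : Prop := a <> Ess.

Definition rule_ss (a : rule) : Prop :=
  match a with AxM1 | AxM2 | Tensor | Lolli | Ess => True | _ => False end.

Lemma step_ms_rule t s : step_ms t s <-> exists a, rule_ms a /\ step a t s.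
Proof.
  unfold step_ms, step_m, union, rule_ms; split.
  - intros [[|[|[|]]]|[|[|[|]]]]; eexists; split; try eassumption; discriminate.
  - intros ([] & Ha & H); tauto.
Qed.

Lemma step_ss_rule t s : step_ss t s <-> exists a, rule_ss a /\ step a t s.
Proof.
  unfold step_ss, step_m, union; split.
  - intros [[|[|[|]]]|]; eexists; split; try eassumption; exact I.
  - intros ([] & Ha & H); cbn in Ha; tauto.
Qed.

(** The one-redex version of [par]. Reduction in the body of any constructor other than a value is
    [red_left] with a one-frame left context. *)
Inductive red : term -> term -> Prop :=
| red_beta v t : red (Cut v (kind_of v) t) (subst_t (inst v) t)
| red_pair_l t t' s : red t t' -> red (Val (VM (Pair t s))) (Val (VM (Pair t' s)))
| red_pair_r t s s' : red s s' -> red (Val (VM (Pair t s))) (Val (VM (Pair t s')))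
| red_lam k t t' : red t t' -> red (Val (VM (Lam k t))) (Val (VM (Lam k t')))
| red_bang t t' : red t t' -> red (Val (VE (Bang t))) (Val (VE (Bang t')))
| red_cut_l v v' k t : red (Val v) (Val v') -> red (Cut v k t) (Cut v' k t)
| red_sub_l m v v' k t : red (Val v) (Val v') -> red (Sub m v k t) (Sub m v' k t)
| red_left L t t' : red t t' -> red (plug_l L t) (plug_l L t').

Lemma steps_map (R R' : relation term) (K : term -> term) :
  (forall t s, R t s -> R' (K t) (K s)) ->
  forall t s, steps R t s -> steps R' (K t) (K s).
Proof.
  intro H; induction 1; [apply rt_step; auto | apply rt_refl | eapply rt_trans; eassumption].
Qed.

Lemma reds_val v t : steps red (Val v) t ->
  exists w, t = Val w /\ (forall k s, steps red (Cut v k s) (Cut w k s)) /\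
    forall m k s, steps red (Sub m v k s) (Sub m w k s).
Proof.
  intro H; apply clos_rt_rt1n in H.
  remember (Val v) as t0 eqn:E; revert v E.
  induction H as [t0 | t0 t1 t2 H1 _ IH]; intros v ->.
  - exists v; repeat split; intros; apply rt_refl.
  - assert (H : exists w, t1 = Val w).
    { remember (Val v) as x eqn:E. clear IH. induction H1; try discriminate;
        try (eexists; reflexivity).
      (* A step under the empty left context is a step of the value itself. *)
      destruct L; try discriminate. exact (IHred E). }
    destruct H as (w & ->). destruct (IH w eq_refl) as (u & -> & Hc & Hs).
    exists u; repeat split; intros;
      (eapply rt_trans; [apply rt_step; constructor; exact H1 | apply Hc || apply Hs]).
Qed.

Lemma steps_red_left L t t' : steps red t t' -> steps red (plug_l L t) (plug_l L t').
Proof. apply steps_map; intros; now apply red_left. Qed.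

Lemma par_red t t' : par t t' -> steps red t t'.
Proof.
  induction 1; try apply rt_refl.
  - eapply rt_trans.
    + apply (steps_map red red (fun x => Val (VM (Pair x s)))); [| exact IHpar1].
      intros; now constructor.
    + apply (steps_map red red (fun x => Val (VM (Pair t' x)))); [| exact IHpar2].
      intros; now constructor.
  - apply (steps_map red red (fun x => Val (VM (Lam k x)))); trivial.
    intros; now constructor.
  - apply (steps_map red red (fun x => Val (VE (Bang x)))); trivial.
    intros; now constructor.
  - destruct (reds_val _ _ IHpar1) as (w & E & Hc & _); injection E as <-.
    eapply rt_trans; [apply Hc | exact (steps_red_left (LCut v' k LHole) _ _ IHpar2)].
  - destruct (reds_val _ _ IHpar1) as (w & E & Hc & _); injection E as <-.
    eapply rt_trans; [apply Hc |].
    eapply rt_trans; [exact (steps_red_left (LCut v' k LHole) _ _ IHpar2) |].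
    apply rt_step; cbn. rewrite <- H, <- (par_kind _ _ H0). constructor.
  - exact (steps_red_left (LPar m k1 k2 LHole) _ _ IHpar).
  - destruct (reds_val _ _ IHpar1) as (w & E & _ & Hs); injection E as <-.
    eapply rt_trans; [apply Hs | exact (steps_red_left (LSub m v' k LHole) _ _ IHpar2)].
  - exact (steps_red_left (LDer e k LHole) _ _ IHpar).
Qed.

(** The head of [x] is the variable that has index [i] outside a context with [n] binders: every
    value of its kind can fire there. *)
Definition located (k : kind) (i : nat) (n : kind -> nat) (x : term) : Prop :=
  forall v, kind_of v = k -> exists y, fires (n k + i) v x y.

(** The only production that separates general from multiplicative contexts is [!], and properness
    forbids a free multiplicative variable under it. *)
Lemma proper_mult :
  (forall V x i, proper (plug_v V x) ->
    wocc (delta Mul (nb_v V Mul + i)) x <> 0 -> mult_v V) /\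
  (forall C x i, proper (plug C x) -> wocc (delta Mul (nb C Mul + i)) x <> 0 -> mult C).
Proof.
  apply contexts_ind; try (cbn; tauto).
  - intros C H s x i; cbn; intros [? _]; eauto.
  - intros s C H x i; cbn; intros [_ ?]; eauto.
  - intros k C H x i; cbn; intros [_ Hp] Hx. apply (H x (one k Mul + i) Hp).
    now replace (nb C Mul + (one k Mul + i)) with (one k Mul + nb C Mul + i) by lia.
  - intros C H x i; cbn; intros [Hc Hp] Hx.
    (* The filler [EVar 0] has no multiplicative occurrence, so the count at the hole is bounded by
       that of the content of the [!], which is 0. *)
    pose proof (proj2 wocc_plug C Mul i x (Val (VE (EVar 0)))) as E.
    specialize (Hc i); rewrite occ_t_wocc in Hc. cbn [wocc wocc_v wocc_e] in E.
    change (delta Mul _ Exp 0) with 0 in E. lia.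
  - intros V H k s x i; cbn; rewrite proper_cut_at; intros [? _]; eauto.
  - intros m V H k s x i; cbn; rewrite proper_sub_at; intros [? _]; eauto.
  - intros L C H x i; cbn; intros Hp Hx. apply (H x (nb_l L Mul + i)).
    + clear - Hp; induction L; trivial; apply IHL; cbn in Hp; tauto.
    + now replace (nb C Mul + (nb_l L Mul + i)) with (nb_l L Mul + nb C Mul + i) by lia.
Qed.

Lemma delta_pos k i k' j : delta k i k' j <> 0 -> k' = k /\ j = i.
Proof.
  unfold delta; destruct (kind_eq_dec k k'); [| congruence].
  destruct (Nat.eqb_spec i j); [auto | congruence].
Qed.

Lemma located_mul j n x : (forall v, exists y, fires (n Mul + j) (VM v) x y) -> located Mul j n x.
Proof. intros H [v | v] E; [apply H | discriminate]. Qed.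

Lemma located_exp j n x : (forall v, exists y, fires (n Exp + j) (VE v) x y) -> located Exp j n x.
Proof. intros H [v | v] E; [discriminate | apply H]. Qed.

Lemma located_shift k i (n n' : kind -> nat) j x :
  located k j n x -> n k + j = n' k + i -> located k i n' x.
Proof. intros H E v Hv; rewrite <- E; now apply H. Qed.

Definition occurs (k : kind) (i : nat) (t : term) : Prop :=
  exists C x, t = plug C x /\ located k i (nb C) x.

(** A value context is required so that it can be reused in [CCut] and [CSub]. *)
Definition occurs_v (k : kind) (i : nat) (v : value) : Prop :=
  exists V x, Val v = plug_v V x /\ located k i (nb_v V) x.

Lemma occurs_left L k i t : occurs k (nb_l L k + i) t -> occurs k i (plug_l L t).
Proof.
  intros (C & x & -> & Hx); exists (CLeft L C), x; split; trivial.
  eapply located_shift; [exact Hx | cbn; lia].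
Qed.

Lemma occurrence :
  (forall v k i, wocc_m (delta k i) v <> 0 -> occurs_v k i (VM v)) /\
  (forall v k i, wocc_e (delta k i) v <> 0 -> occurs_v k i (VE v)) /\
  (forall v k i, wocc_v (delta k i) v <> 0 -> occurs_v k i v) /\
  (forall t k i, wocc (delta k i) t <> 0 -> occurs k i t).
Proof.
  apply syntax_ind; cbn.
  - intros m k i H; apply delta_pos in H as [<- <-].
    exists VHole, (Val (VM (MVar m))); split; trivial.
    apply located_mul; eexists; constructor.
  - intros t IHt s IHs k i H.
    destruct (Nat.eq_dec (wocc (delta k i) t) 0) as [E | E].
    + destruct (IHs k i) as (C & x & -> & Hx); [lia |]. now exists (VPairR t C), x.
    + destruct (IHt k i E) as (C & x & -> & Hx). now exists (VPairL C s), x.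
  - intros k t IHt j i H; rewrite upw_delta in H.
    destruct (IHt _ _ H) as (C & x & -> & Hx). exists (VLam k C), x; split; trivial.
    eapply located_shift; [exact Hx | cbn; unfold wk, shift; lia].
  - intros e k i H; apply delta_pos in H as [<- <-].
    exists VHole, (Val (VE (EVar e))); split; trivial.
    apply located_exp; eexists; constructor.
  - intros t IHt k i H. destruct (IHt k i H) as (C & x & -> & Hx). now exists (VBang C), x.
  - trivial.
  - trivial.
  - intros v IHv k i H. destruct (IHv k i H) as (V & x & E & Hx). now exists (CVal V), x.
  - intros v IHv k t IHt j i H; rewrite upw_delta in H.
    destruct (Nat.eq_dec (wocc_v (delta j i) v) 0) as [E | E].
    + apply (occurs_left (LCut v k LHole)).
      replace (nb_l _ j + i) with (wk k j i) by (cbn; unfold wk, shift; lia). apply IHt; lia.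
    + destruct (IHv j i E) as (V & x & Ev & Hx). exists (CCut V k t), x; split; trivial.
      cbn; now rewrite <- Ev, cut_at_val.
  - intros m k1 k2 t IHt j i H; rewrite !upw_delta in H.
    destruct (Nat.eq_dec (delta j i Mul m) 0) as [E | E].
    + apply (occurs_left (LPar m k1 k2 LHole)).
      replace (nb_l _ j + i) with (wk k2 j (wk k1 j i)) by (cbn; unfold wk, shift; lia).
      apply IHt; lia.
    + apply delta_pos in E as [<- <-]. exists (CVal VHole); eexists; split; [reflexivity |].
      apply located_mul; eexists; constructor.
  - intros m v IHv k t IHt j i H; rewrite upw_delta in H.
    destruct (Nat.eq_dec (delta j i Mul m) 0) as [E0 | E0].
    + destruct (Nat.eq_dec (wocc_v (delta j i) v) 0) as [E | E].
      * apply (occurs_left (LSub m v k LHole)).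
        replace (nb_l _ j + i) with (wk k j i) by (cbn; unfold wk, shift; lia).
        apply IHt; lia.
      * destruct (IHv j i E) as (V & x & Ev & Hx). exists (CSub m V k t), x; split; trivial.
        cbn; now rewrite <- Ev, sub_at_val.
    + apply delta_pos in E0 as [<- <-]. exists (CVal VHole); eexists; split; [reflexivity |].
      apply located_mul; eexists; constructor.
  - intros e k t IHt j i H; rewrite upw_delta in H.
    destruct (Nat.eq_dec (delta j i Exp e) 0) as [E0 | E0].
    + apply (occurs_left (LDer e k LHole)).
      replace (nb_l _ j + i) with (wk k j i) by (cbn; unfold wk, shift; lia).
      apply IHt; lia.
    + apply delta_pos in E0 as [<- <-]. exists (CVal VHole); eexists; split; [reflexivity |].
      apply located_exp; eexists; constructor.
Qed.

Lemma occurrence_fires v t : wocc (delta (kind_of v) 0) t <> 0 ->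
  exists C x y, t = plug C x /\ fires (nb C (kind_of v)) (ren_v (into (kind_of v) C) v) x y.
Proof.
  intro H; destruct (proj2 (proj2 (proj2 occurrence)) _ _ _ H) as (C & x & -> & Hx).
  destruct (Hx (ren_v (into (kind_of v) C) v)) as (y & Hy); [now destruct v |].
  rewrite Nat.add_0_r in Hy. now exists C, x, y.
Qed.

Lemma root_fires_exp v C x y :
  fires (nb C Exp) (ren_v (into Exp C) (VE v)) x y ->
  exists a, rule_ms a /\ root a (Cut (VE v) Exp (plug C x)) (Cut (VE v) Exp (plug C y)).
Proof.
  intro H; remember (ren_v (into Exp C) (VE v)) as w eqn:E; destruct H; try discriminate E;
    injection E as ->.
  - exists AxE1; split; [discriminate | apply root_axe1].
  - destruct v as [f | s]; cbn.
    + exists AxE2; split; [discriminate | apply root_axe2].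
    + exists BangDer; split; [discriminate | apply root_bangder].
Qed.

(** Induction on the number of occurrences of the cut variable: each micro step removes exactly one
    and leaves the final substitution unchanged; at zero, [Weak] applies. *)
Lemma root_ess_steps v t : steps step_ms (Cut (VE v) Exp t) (subst_t (inst (VE v)) t).
Proof.
  remember (wocc (delta Exp 0) t) as n eqn:E; revert t E.
  induction n as [| n IH]; intros t E.
  - destruct (unused_wk Exp t (eq_sym E)) as (t' & ->).
    pose proof (subst_t_inst_wk (VE v) t') as E'; cbn [kind_of] in E'; rewrite E'.
    apply rt_step, step_ms_rule.
    exists Weak; split; [discriminate | apply step_root, root_weak].
  - destruct (occurrence_fires (VE v) t) as (C & x & y & -> & H); [cbn; lia |].
    destruct (root_fires_exp v C x y H) as (a & Ha & Hr).
    eapply rt_trans.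
    + apply rt_step, step_ms_rule. exists a; split; [exact Ha | apply step_root, Hr].
    + rewrite (subst_fires_plug C (VE v) x y H). apply IH.
      pose proof (wocc_fires_plug C (VE v) x y H) as E'; cbn in E'; lia.
Qed.

Lemma step_ms_plug C t s : step_ms t s -> step_ms (plug C t) (plug C s).
Proof.
  rewrite !step_ms_rule; intros (a & Ha & H); exists a; split; [assumption | now apply step_plug].
Qed.

Lemma step_ss_plug C t s : step_ss t s -> step_ss (plug C t) (plug C s).
Proof.
  rewrite !step_ss_rule; intros (a & Ha & H); exists a; split; [assumption | now apply step_plug].
Qed.

Lemma step_ss_steps_ms t s : step_ss t s -> steps step_ms t s.
Proof.
  rewrite step_ss_rule; intros (a & Ha & H).
  destruct a; try contradiction Ha;
    try (apply rt_step, step_ms_rule; eexists; split; [| exact H]; discriminate).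
  destruct H as [C t s H]. inversion H; subst.
  apply (steps_map step_ms step_ms); [intros; now apply step_ms_plug |].
  rewrite es_t_subst. apply root_ess_steps.
Qed.

Lemma clash_free_steps t s : steps step_ms t s -> clash_free t -> clash_free s.
Proof.
  induction 1; auto. intro Ht; now apply (reduct_clash_free _ Ht).
Qed.

Lemma subterm_refl t : subterm t t.
Proof. destruct t; now left. Qed.

Lemma subterm_plug_l L c t : subterm c t -> subterm c (plug_l L t).
Proof. induction L; cbn; auto. Qed.

(** Linearity provides an occurrence of the cut variable and makes it unique; properness makes its
    context multiplicative. Once it has fired, the variable is gone, so the body is the weakening of
    some [r], and [r] is the substituted body. *)
Lemma root_mul v t : proper (Cut (VM v) Mul t) -> ~ clash (Cut (VM v) Mul t) ->
  step_ss (Cut (VM v) Mul t) (subst_t (inst (VM v)) t).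
Proof.
  intros (Hv & Hb & Ht) Hc. apply step_ss_rule.
  rewrite binds_linearly_wocc in Hb; specialize (Hb eq_refl).
  destruct (occurrence_fires (VM v) t) as (C & x & y & -> & Hf); [cbn; lia |].
  assert (M : mult C).
  { apply (proj2 proper_mult C x 0 Ht). rewrite Nat.add_0_r.
    pose proof (wocc_fires_into C (VM v) x y Hf) as E; cbn [kind_of] in E; lia. }
  pose proof (wocc_fires_plug C (VM v) x y Hf) as E; cbn in E; rewrite Hb in E.
  destruct (unused_wk Mul (plug C y)) as (r & Er); [lia |].
  pose proof (subst_fires_plug C (VM v) x y Hf) as Es.
  rewrite Er in Es. pose proof (subst_t_inst_wk (VM v) r) as E'; cbn [kind_of] in E'.
  rewrite E' in Es; rewrite Es.
  destruct v as [n | t u | k t]; [| | ].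
  - exists AxM2; split; [exact I |]. apply step_root.
    (* Substituting a variable is a renaming, so [AxM2] serves whatever the form of the
       occurrence. *)
    replace r with (ren_t (inst_mul n) (plug C x)); [apply root_axm2 |].
    rewrite <- Es, <- of_ren_t; f_equal; ext_subst; reflexivity.
  - remember (VM (Pair t u)) as v eqn:Ev; remember (ren_v (into (kind_of v) C) v) as w eqn:Ew.
    destruct Hf; subst v; cbn in Ew; try discriminate Ew; injection Ew as ->.
    + exists AxM1; split; [exact I | now apply step_root, root_axm1].
    + exists Tensor; split; [exact I |]. apply step_root, root_tensor; [assumption |].
      rewrite <- ren_t_ren; exact Er.
    (* A pair meeting a [Sub] is a clash, which is excluded. *)
    + destruct Hc; now apply clash_tensor.
  - remember (VM (Lam k t)) as v eqn:Ev; remember (ren_v (into (kind_of v) C) v) as w' eqn:Ew.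
    destruct Hf; subst v; cbn in Ew; try discriminate Ew; injection Ew as ->.
    + exists AxM1; split; [exact I | now apply step_root, root_axm1].
    + destruct Hc; now apply clash_lolli.
    + exists Lolli; split; [exact I |]. now apply step_root, root_lolli.
Qed.

Lemma red_step_ss t t' : red t t' -> proper t -> (forall c, subterm c t -> ~ clash c) ->
  step_ss t t'.
Proof.
  assert (P : forall C t s, proper (plug C t) ->
    (proper t -> (forall c, subterm c t -> ~ clash c) -> step_ss t s) ->
    (forall c, subterm c t -> subterm c (plug C t)) ->
    (forall c, subterm c (plug C t) -> ~ clash c) -> step_ss (plug C t) (plug C s)).
  { intros C t0 s Hp H Hs Hc. apply step_ss_plug, H; [| auto].
    now apply (proj2 (proper_plug_inv t0) C). }
  (* In value position of a cut or a sub, [Val v] does not count as a subterm, but the subterms of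
     [v] do, and [Val v] itself is not a clash. *)
  assert (Q : forall C v v', proper (plug C (Val v)) ->
    (proper (Val v) -> (forall c, subterm c (Val v) -> ~ clash c) ->
      step_ss (Val v) (Val v')) ->
    (forall c, sub_v c v -> subterm c (plug C (Val v))) ->
    (forall c, subterm c (plug C (Val v)) -> ~ clash c) ->
    step_ss (plug C (Val v)) (plug C (Val v'))).
  { intros C v v' Hp H Hs Hc. apply step_ss_plug, H.
    - now apply (proj2 (proper_plug_inv (Val v)) C).
    - intros c [-> | Hcv]; [intro K; inversion K | auto]. }
  induction 1 as [v t | t t' s _ IH | t s s' _ IH | k t t' _ IH | t t' _ IH
    | v v' k t _ IH | m v v' k t _ IH | L t t' _ IH]; intros Hp Hc.
  - destruct v as [v | v].
    + apply root_mul; [assumption | apply Hc, subterm_refl].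
    + apply step_ss_rule; exists Ess; split; [exact I |].
      apply step_root. change (inst (VE v)) with (Subst MVar (inst_exp v)).
      rewrite <- (es_t_subst t (inst_exp v)).
      apply root_ess.
  - apply (P (CVal (VPairL (CVal VHole) s))); trivial; cbn; auto.
  - apply (P (CVal (VPairR t (CVal VHole)))); trivial; cbn; auto.
  - apply (P (CVal (VLam k (CVal VHole)))); trivial; cbn; auto.
  - apply (P (CVal (VBang (CVal VHole)))); trivial; cbn; auto.
  - rewrite <- (cut_at_val v), <- (cut_at_val v') in *.
    apply (Q (CCut VHole k t)); trivial; intros c Hcv.
    change (subterm c (cut_at (Val v) k t)); rewrite cut_at_val; cbn; auto.
  - rewrite <- (sub_at_val m v), <- (sub_at_val m v') in *.
    apply (Q (CSub m VHole k t)); trivial; intros c Hcv.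
    change (subterm c (sub_at m (Val v) k t)); rewrite sub_at_val; cbn; auto.
  - apply (P (CLeft L (CVal VHole))); trivial. intro; apply subterm_plug_l.
Qed.

(** * Transfer of confluence to the two relations *)

Lemma step_ss_proper t s : step_ss t s -> proper t -> proper s.
Proof. rewrite step_ss_rule; intros (a & _ & H); exact (step_proper a t s H). Qed.

Lemma step_ms_proper t s : step_ms t s -> proper t -> proper s.
Proof. rewrite step_ms_rule; intros (a & _ & H); exact (step_proper a t s H). Qed.

(** Clash-freeness is preserved by micro steps by definition, so each [step_ss] is expanded into
    micro steps to carry the invariant along. *)
Lemma reds_steps_ss t s : steps red t s -> proper t -> clash_free t -> steps step_ss t s.
Proof.
  intro H; apply clos_rt_rt1n in H; induction H as [t | t u s H _ IH]; intros Hp Hc.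
  - apply rt_refl.
  - assert (K : step_ss t u) by (apply red_step_ss; trivial; apply (no_clash _ Hc)).
    eapply rt_trans; [apply rt_step, K |]. apply IH.
    + now apply (step_ss_proper t).
    + apply (clash_free_steps t); [now apply step_ss_steps_ms | assumption].
Qed.

Lemma steps_flat_map (R R' : relation term) :
  (forall t s, R t s -> steps R' t s) -> forall t s, steps R t s -> steps R' t s.
Proof.
  intro H; induction 1; [auto | apply rt_refl | eapply rt_trans; eassumption].
Qed.

Lemma steps_invariant (R : relation term) (P : term -> Prop) :
  (forall t s, R t s -> P t -> P s) -> forall t s, steps R t s -> P t -> P s.
Proof. intro H; induction 1; eauto. Qed.

Lemma pars_steps_ss t s : steps par t s -> proper t -> clash_free t -> steps step_ss t s.
Proof.
  intro H; apply reds_steps_ss. revert t s H; apply steps_flat_map, par_red.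
Qed.

Lemma steps_joinable (R : relation term) :
  (forall t s, R t s -> joinable t s) -> forall t s, steps R t s -> joinable t s.
Proof.
  intro H; induction 1; [auto | exists x; split; apply rt_refl |].
  eapply joinable_trans; eassumption.
Qed.

Lemma joinable_sym t s : joinable t s -> joinable s t.
Proof. intros (u & H1 & H2); now exists u. Qed.

(** The two reducts are joinable by [par] through their common origin. Since both are still proper
    and clash-free, the joining reductions are realised by [step_ss], hence by [R]. *)
Lemma confluent_from_joinable (R : relation term) :
  (forall t s, R t s -> joinable t s) ->
  (forall t s, R t s -> proper t /\ clash_free t -> proper s /\ clash_free s) ->
  (forall t s, step_ss t s -> steps R t s) ->
  confluent_on (fun t => proper t /\ clash_free t) R.
Proof.
  intros HJ HP HS t s1 s2 Ht H1 H2.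
  assert (J : joinable s1 s2).
  { apply (joinable_trans s1 t); [apply joinable_sym |]; now apply (steps_joinable R). }
  destruct J as (u & J1 & J2).
  destruct (steps_invariant R _ HP _ _ H1 Ht), (steps_invariant R _ HP _ _ H2 Ht).
  exists u; split; apply (steps_flat_map step_ss R HS); now apply pars_steps_ss.
Qed.

Theorem theorem10p3 :
  confluent_on (fun t => proper t /\ clash_free t) step_ss /\
  confluent_on (fun t => proper t /\ clash_free t) step_ms.
Proof.
  split; apply confluent_from_joinable.
  - intros t s; rewrite step_ss_rule; intros (a & _ & H); now apply (step_joinable a).
  - intros t s H [Hp Hc]; split; [now apply (step_ss_proper t) |].
    apply (clash_free_steps t); [now apply step_ss_steps_ms | assumption].
  - intros; now apply rt_step.
  - intros t s; rewrite step_ms_rule; intros (a & _ & H); now apply (step_joinable a).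
  - intros t s H [Hp Hc]; split; [now apply (step_ms_proper t) |].
    now apply (reduct_clash_free t).
  - apply step_ss_steps_ms.
Qed.
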